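(* Let $H_1,H_2$ be separable Hilbert spaces with $\dim H_1=\infty$ and consider the linear model $Y_k=\Psi(X_k)+\varepsilon_k$, $k\ge 1$, where Assumption (A) (stated in the context) holds and $H_1=\overline{\mathrm{Im}(C)}$, with $C=E[X_1\otimes X_1]$. Suppose that the eigenvalues $\lambda_1,\lambda_2,\dots$ of $C$ are mutually distinct and that $\Psi$ is a Hilbert–Schmidt operator. Let $m_n\to\infty$ with $m_n^6=o(n)$, and let $$K_n=\min(B_n,E_n,m_n),\qquad B_n=\max\{j\ge1:\hat\lambda_j^{-1}\le m_n\},\qquad E_n=\max\Big\{k\ge1:\max_{1\le j\le k}\hat\alpha_j^{-1}\le m_n\Big\}.$$ Then the estimator $\hat\Psi_{K_n}(x)=\sum_{j=1}^{K_n}\frac{\hat\Delta(\hat v_j)}{\hat\lambda_j}\langle\hat v_j,x\rangle_{H_1}$ is weakly consistent, i.e. $\|\hat\Psi_{K_n}-\Psi\|_{\mathcal L(H_1,H_2)}\to0$ in probability as $n\to\infty$.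
   Context: Notation: all random variables are defined on a common probability space. $\mathcal L(H_i,H_j)$ is the space of bounded linear operators from $H_i$ to $H_j$ with operator norm $\|\cdot\|_{\mathcal L(H_i,H_j)}$. For $x\in H_i$, $y\in H_j$, $x\otimes y:H_i\to H_j$ is $(x\otimes y)(v)=\langle x,v\rangle y$. $\nu_{p,H}(X):=(E\|X\|_H^p)^{1/p}$, and $X\in L^p_H$ means $\nu_{p,H}(X)<\infty$. For $X,Y$ with finite second moments, $X\perp Y$ means $E[X\otimes Y]=0$. $H$-white noise: a sequence of orthogonal elements of $L^2_H$ with constant mean and constant covariance operator. $L^p$–$m$–approximability: a random sequence $\{X_n\}_{n\ge1}$ with values in $H$ is $L^p$–$m$–approximable if it can be represented as $X_n=f(\delta_n,\delta_{n-1},\dots)$, where the $\delta_i$ are i.i.d. elements of a measurable space $S$ and $f:S^\infty\to H$ is measurable, and if, with $\delta_i'$ independent copies of the $\delta_i$ on the same probability space and $X_n^{(m)}=f(\delta_n,\dots,\delta_{n-m+1},\delta'_{n-m},\delta'_{n-m-1},\dots)$, one has $\sum_{m\ge1}\nu_{p,H}(X_m-X_m^{(m)})<\infty$. An $L^4$–$m$–approximable sequence is understood to have finite fourth moments. Assumption (A): $\Psi\in\mathcal L(H_1,H_2)$; $\{X_k\}$ (values in $H_1$) and $\{\varepsilon_k\}$ (values in $H_2$) are zero mean and $L^4$–$m$–approximable; $\{\varepsilon_k\}$ is $H_2$-white noise; $X_k\perp\varepsilon_k$ for every $k\ge1$. $C$ has eigenvalues $\lambda_1\ge\lambda_2\ge\cdots$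 (all positive, as $H_1=\overline{\mathrm{Im}(C)}$). From the sample $(X_1,Y_1),\dots,(X_n,Y_n)$ put $\hat C=\frac1n\sum_{k=1}^nX_k\otimes X_k$ and $\hat\Delta=\frac1n\sum_{k=1}^nX_k\otimes Y_k$. $\hat\lambda_1\ge\hat\lambda_2\ge\cdots\ge0$ are the eigenvalues of $\hat C$, $\hat v_j$ corresponding orthonormal eigenvectors, $\hat\alpha_1=\hat\lambda_1-\hat\lambda_2$ and $\hat\alpha_j=\min\{\hat\lambda_{j-1}-\hat\lambda_j,\hat\lambda_j-\hat\lambda_{j+1}\}$ for $j>1$. Conventions: $1/0=+\infty$, $\max\emptyset=0$, a non-integer minimum defining $K_n$ is rounded down, and empty sums are $0$.
   Formalization: The regressors X_k and the noise ε_k are assumed L^4–m–approximable with respect to the same i.i.d. innovations δ_i and copies δ_i' (joint approximability); with unrelated innovations the claim fails. Hilbert spaces are real. *)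

(* Defs.v *)
From HB Require Import structures.
From mathcomp Require Import all_boot all_order all_algebra.
From mathcomp Require Import all_classical all_reals all_analysis.

Set Implicit Arguments.
Unset Strict Implicit.
Unset Printing Implicit Defensive.

Import Order.TTheory GRing.Theory Num.Theory.
Import numFieldNormedType.Exports.

Local Open Scope classical_set_scope.
Local Open Scope ring_scope.

(* MathComp-Analysis.  Hilbert spaces are real: complete normed modules over
   [R : realType] whose norm comes from an inner product. *)
HB.mixin Record CompleteNormedModule_isHilbert (R : realType) H
    & CompleteNormedModule R H := {
  inner : H -> H -> R ;
  innerC : forall x y, inner x y = inner y x ;
  innerDl : forall x y z, inner (x + y) z = inner x z + inner y z ;
  innerZl : forall (a : R) x y, inner (a *: x) y = a * inner x y ;
  sqr_norm_inner : forall x, `|x| ^+ 2 = inner x x }.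

#[short(type="hilbertType")]
HB.structure Definition Hilbert (R : realType) :=
  {H of CompleteNormedModule R H & CompleteNormedModule_isHilbert R H}.

Section HilbertSpaces.
Variable R : realType.

Definition separable (T : topologicalType) : Prop :=
  exists2 D : set T, countable D & dense D.

Definition infinite_dimensional (H : hilbertType R) : Prop :=
  forall (n : nat) (s : 'I_n -> H),
    exists x : H, forall c : 'I_n -> R, x <> \sum_(i < n) c i *: s i.

Definition tens (H1 H2 : hilbertType R) (x : H1) (y : H2) : H1 -> H2 :=
  fun v => inner x v *: y.

(* Valued in [\bar R], so that it is [+oo] on unbounded maps. *)
Definition opnorm (H1 H2 : hilbertType R) (T : H1 -> H2) : \bar R :=
  ereal_sup [set (`|T x|)%:E | x in [set x : H1 | `|x| <= 1]].

Definition orthonormal_seq (H : hilbertType R) (e : nat -> H) : Prop :=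
  forall i j, inner (e i) (e j) = (i == j)%:R.

Definition orthonormal_basis (H : hilbertType R) (e : nat -> H) : Prop :=
  orthonormal_seq e /\
  forall x : H, series (fun j => inner (e j) x *: e j) @ \oo --> x.

(* Bases are indexed by [nat]: [H1] is meant to be separable and
   infinite-dimensional. *)
Definition hilbert_schmidt (H1 H2 : hilbertType R) (T : H1 -> H2) : Prop :=
  exists2 e : nat -> H1, orthonormal_basis e &
    (\sum_(0 <= j <oo) (`|T (e j)| ^+ 2)%:E < +oo)%E.

(* [lam 1 >= lam 2 >= ... >= 0] are the eigenvalues of the operator [T],
   repeated according to multiplicity, with orthonormal eigenvectors
   [v 1, v 2, ...]; index 0 is unused.  The last clause says that every nonzero
   eigenvalue is listed as often as its multiplicity.  The eigenvectors attached
   to the eigenvalue 0 need not span the kernel of [T]. *)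
Definition eigensystem (H : hilbertType R) (T : H -> H)
    (lam : nat -> R) (v : nat -> H) : Prop :=
  [/\ orthonormal_seq (fun j => v j.+1),
      (forall j, (0 < j)%N -> T (v j) = lam j *: v j),
      (forall j, (0 < j)%N -> 0 <= lam j),
      (forall i j, (0 < i <= j)%N -> lam j <= lam i) &
      forall (mu : R) (x : H), mu != 0 -> T x = mu *: x ->
        exists N : nat,
          x = \sum_(1 <= j < N | lam j == mu) inner (v j) x *: v j].

End HilbertSpaces.

Section RandomElements.
Context {d : measure_display} {Omega : measurableType d} {R : realType}.
Variable P : probability Omega R.

Definition borel_measurable (H : topologicalType) (X : Omega -> H) : Prop :=
  forall U : set H, open U -> measurable (X @^-1` U).

(* nu_{p,H}(X) = (E ||X||_H^p)^{1/p} *)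
Definition nu (p : R) (H : hilbertType R) (X : Omega -> H) : \bar R :=
  Lnorm P p%:E (fun w => (`|X w|)%:E).

(* [E X = m]: [X] is a random element with [E ||X|| < oo], and [m] is the vector
   with [<m, y> = E <X, y>] for all [y]. *)
Definition is_mean (H : hilbertType R) (X : Omega -> H) (m : H) : Prop :=
  [/\ borel_measurable X,
      P.-integrable setT (fun w => (`|X w|)%:E) &
      forall y : H, ('E_P[fun w => inner (X w) y] = (inner m y)%:E)%E].

(* [E (X (x) Y) = C], the expectation of the random operator [X (x) Y] being
   taken pointwise: [C v = E (<X, v> Y)]. *)
Definition is_mean_tens (H1 H2 : hilbertType R)
    (X : Omega -> H1) (Y : Omega -> H2) (C : H1 -> H2) : Prop :=
  forall v : H1, is_mean (fun w => tens (X w) (Y w) v) (C v).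

Definition orthogonal_rv (H1 H2 : hilbertType R)
    (X : Omega -> H1) (Y : Omega -> H2) : Prop :=
  is_mean_tens X Y (fun=> 0).

Definition white_noise (H : hilbertType R) (e : nat -> Omega -> H) : Prop :=
  [/\ forall k, (0 < k)%N -> borel_measurable (e k) /\ (nu 2 (e k) < +oo)%E,
      forall k l, (0 < k)%N -> (0 < l)%N -> k <> l ->
        orthogonal_rv (e k) (e l) &
      exists (mu : H) (Gamma : H -> H), forall k, (0 < k)%N ->
        is_mean (e k) mu /\
        is_mean_tens (fun w => e k w - mu) (fun w => e k w - mu) Gamma].

Section Approximability.
Context {dS : measure_display} {S : measurableType dS}.

Definition mutually_independent (I : choiceType) (Z : I -> Omega -> S) : Prop :=
  forall (s : seq I) (A : I -> set S), uniq s ->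
    (forall i, measurable (A i)) ->
    P (\bigcap_(i in [set` s]) (Z i @^-1` A i)) =
    (\prod_(i <- s) P (Z i @^-1` A i))%E.

Definition iid (I : choiceType) (Z : I -> Omega -> S) : Prop :=
  [/\ forall i, measurable_fun setT (Z i),
      mutually_independent Z &
      forall i j (A : set S), measurable A ->
        P (Z i @^-1` A) = P (Z j @^-1` A)].

(* [delta] is an i.i.d. two-sided sequence and [delta'] an independent copy of
   it. *)
Definition innovations (delta delta' : int -> Omega -> S) : Prop :=
  iid (fun bi : bool * int => if bi.1 then delta' bi.2 else delta bi.2).

Definition cylinders : set (set (nat -> S)) :=
  [set B | exists i (A : set S), measurable A /\ B = [set s | A (s i)]].

Definition seq_measurable (H : topologicalType) (f : (nat -> S) -> H) : Prop :=
  forall U : set H, open U -> <<s cylinders >> (f @^-1` U).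

Definition causal (H : Type) (f : (nat -> S) -> H)
    (delta : int -> Omega -> S) (n : nat) : Omega -> H :=
  fun w => f (fun i => delta (n%:Z - i%:Z) w).

(* X_n^{(m)} = f(delta_n, ..., delta_{n-m+1}, delta'_{n-m}, ...) *)
Definition coupled_causal (H : Type) (f : (nat -> S) -> H)
    (delta delta' : int -> Omega -> S) (m n : nat) : Omega -> H :=
  fun w => f (fun i => if (i < m)%N then delta (n%:Z - i%:Z) w
                       else delta' (n%:Z - i%:Z) w).

(* L^p-m-approximability with respect to given innovations [delta, delta'],
   with finite moments of order [p]. *)
Definition Lp_m_approximable (p : R) (H : hilbertType R)
    (delta delta' : int -> Omega -> S) (X : nat -> Omega -> H) : Prop :=
  exists f : (nat -> S) -> H,
    [/\ seq_measurable f,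
        (forall n, (0 < n)%N -> X n = causal f delta n),
        (forall n, (0 < n)%N -> (nu p (X n) < +oo)%E) &
        (\sum_(1 <= m <oo)
           nu p (fun w => (X m w - coupled_causal f delta delta' m m w)%R)
         < +oo)%E].

(* Regressors and noise share their innovations, i.e. they are jointly
   approximable; approximability of each of them alone does not control the
   cross products [X_k (x) eps_k].  For instance, let [X_k = sum_j a_j xi_kj v_j]
   with independent random signs [xi_kj], and [eps_k = Z xi_k1 y] with [Z] one
   more independent random sign: both sequences are i.i.d. and
   [E (X_k (x) eps_k) = 0], but [n^-1 sum_(k <= n) X_k (x) eps_k] tends to
   [Z a_1 (v_1 (x) y)]. *)
Record assumption_A (H1 H2 : hilbertType R)
    (delta delta' : int -> Omega -> S) (Psi : H1 -> H2)
    (X : nat -> Omega -> H1) (eps : nat -> Omega -> H2) : Prop := AssumptionA {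
  A_linear : linear Psi ;
  A_continuous : continuous Psi ;
  A_innovations : innovations delta delta' ;
  A_meanX : forall k, (0 < k)%N -> is_mean (X k) 0 ;
  A_mean_eps : forall k, (0 < k)%N -> is_mean (eps k) 0 ;
  A_approxX : Lp_m_approximable 4 delta delta' X ;
  A_approx_eps : Lp_m_approximable 4 delta delta' eps ;
  A_white_noise : white_noise eps ;
  A_orthogonal : forall k, (0 < k)%N -> orthogonal_rv (X k) (eps k) }.

End Approximability.

(* Convergence to 0 in probability; the outer measure is [P] itself on
   measurable events, and dispenses with choosing the eigenvectors of the
   empirical covariance operator measurably. *)
Definition cvg_probability0 (Z : nat -> Omega -> \bar R) : Prop :=
  forall e : R, 0 < e ->
    (P^*)%mu [set w | (e%:E < Z n w)%E] @[n --> \oo] --> 0%E.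

End RandomElements.

Section Estimator.
Context {d : measure_display} {Omega : measurableType d} {R : realType}.

(* (1/n) sum_{k=1}^n X_k (x) Y_k; the empirical covariance operator when
   Y = X. *)
Definition emp_cov (H1 H2 : hilbertType R) (X : nat -> Omega -> H1)
    (Y : nat -> Omega -> H2) (n : nat) (w : Omega) : H1 -> H2 :=
  fun v => n%:R^-1 *: \sum_(1 <= k < n.+1) tens (X k w) (Y k w) v.

(* Maximum of a set of natural numbers; 0 on the empty set (and on unbounded
   sets). *)
Definition max_set (A : set nat) : nat :=
  xget 0%N [set k | A k /\ forall j, A j -> (j <= k)%N].

Definition gap (lam : nat -> R) (j : nat) : R :=
  if j == 1%N then lam 1%N - lam 2%N
  else Num.min (lam j.-1 - lam j) (lam j - lam j.+1).

(* The inverses are those of [\bar R], where [0^-1 = +oo]. *)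
Definition Bn (lam : nat -> R) (m : R) : nat :=
  max_set [set j | (0 < j)%N /\ ((lam j)%:E^-1 <= m%:E)%E].

Definition En (lam : nat -> R) (m : R) : nat :=
  max_set [set k | (0 < k)%N /\
    (\big[maxe/-oo]_(1 <= j < k.+1) (gap lam j)%:E^-1 <= m%:E)%E].

Definition Kn (lam : nat -> R) (m : R) : nat :=
  Num.truncn (Num.min (Num.min (Bn lam m)%:R (En lam m)%:R) m).

Definition Psi_hat (H1 H2 : hilbertType R) (Delta : H1 -> H2)
    (lam : nat -> R) (v : nat -> H1) (K : nat) : H1 -> H2 :=
  fun x => \sum_(1 <= j < K.+1)
    inner (v j) x *: ((lam j)^-1 *: Delta (v j)).

End Estimator.

(* Main.v *)
(* Write C^ for the empirical covariance operator, E^ for the empirical cross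
   covariance of regressors and noise, and Q for the projection off the leading
   K_n empirical eigenvectors.  Since Delta^ = Psi C^ + E^, the estimator equals
   Psi (1 - Q) plus a noise term of norm at most m_n |E^|.

   Coupling each X_k, eps_k at lag m with an independent copy shows that the
   covariances of the Hilbert-Schmidt valued X_k (x) eps_k and X_k (x) X_k are
   summable, so |E^| and |C^ - C| are O(n^(-1/2)) in L^2; as m_n^2 = o(n), the
   noise term vanishes.  By the minimax principle the eigenvalues of C^ converge
   to those of C, whose gaps are positive, hence K_n tends to infinity.  No
   perturbation theory of eigenvectors is needed: at a vector C z,
   |Q C z| <= |C^ - C| |z| + |C^ Q z|, and |C^ Q| is at most the empirical
   eigenvalue of index K_n + 1, which is small.  As C has dense range, Q tends to
   0 strongly, so Psi Q tends to 0 in norm because Psi is Hilbert-Schmidt. *)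

Require Import Defs.
From HB Require Import structures.
From mathcomp Require Import all_boot all_order all_algebra.
From mathcomp Require Import all_classical all_reals all_analysis.
From mathcomp Require Import measurable_realfun zify ring lra.

Set Implicit Arguments.
Unset Strict Implicit.
Unset Printing Implicit Defensive.

Import Order.TTheory GRing.Theory Num.Theory.
Import numFieldNormedType.Exports.

Local Open Scope classical_set_scope.
Local Open Scope ring_scope.

(** The empirical eigenvectors are arbitrary functions of the sample point, so nothing built from
    them can be integrated. The spectral part is therefore deterministic: it treats any positive
    operator [T] close to [C] and any eigensystem of [T], and ends in [estimator_close]. Probability
    enters only through the squared Hilbert-Schmidt norms of C^ - C and E^. Computed in one fixed
    basis [e], they are countable sums of measurable functions; the events where they are large
    cover the bad event, and Markov's inequality bounds its outer measure. An eigensystem need not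
    span the kernel, which for the finite-rank C^ is infinite-dimensional, so no expansion of a
    vector in eigenvectors is available. Bounds off the leading eigenvectors come instead from
    maximizing the quadratic form over a closed invariant set, and [trace_le] records the properties
    that C and C^ share for this purpose. *)

Lemma discriminant_le (R : realFieldType) (a b c : R) : 0 <= c ->
  (forall t, 0 <= a + 2 * b * t + c * t ^+ 2) -> b ^+ 2 <= a * c.
Proof.
rewrite le_eqVlt => /predU1P[<- h|c0 /(_ (- b / c))].
  rewrite mulr0 real_exprn_even_le0//=; apply: contraT => b0.
  (* For [c = 0] the polynomial is affine, and a nonzero slope would bring it to -1 here. The case
     does occur: the form of a positive operator may be degenerate. *)
  have := h (- (a + 1) / (2 * b)).
  have -> : a + 2 * b * (- (a + 1) / (2 * b)) +
    0 * (- (a + 1) / (2 * b)) ^+ 2 = - 1 by field.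
  by rewrite oppr_ge0 ler10.
have -> : a + 2 * b * (- b / c) + c * (- b / c) ^+ 2 = a - b ^+ 2 / c.
  by field; rewrite gt_eqF.
by rewrite subr_ge0 ler_pdivrMr.
Qed.

(** * Inner products and finite orthonormal families *)

Section InnerProduct.
Variables (R : realType) (H : hilbertType R).
Implicit Types x y z : H.

Lemma innerDr x y z : inner x (y + z) = inner x y + inner x z.
Proof. by rewrite innerC innerDl !(innerC _ x). Qed.

Lemma innerZr a x y : inner x (a *: y) = a * inner x y.
Proof. by rewrite innerC innerZl innerC. Qed.

Lemma inner0l y : inner 0 y = 0.
Proof. by rewrite -(scale0r (0 : H)) innerZl mul0r. Qed.

Lemma inner0r y : inner y 0 = 0.
Proof. by rewrite innerC inner0l. Qed.

Lemma innerNl x y : inner (- x) y = - inner x y.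
Proof. by rewrite -scaleN1r innerZl mulN1r. Qed.

Lemma innerNr x y : inner x (- y) = - inner x y.
Proof. by rewrite innerC innerNl innerC. Qed.

Lemma innerBl x y z : inner (x - y) z = inner x z - inner y z.
Proof. by rewrite innerDl innerNl. Qed.

Lemma innerBr x y z : inner x (y - z) = inner x y - inner x z.
Proof. by rewrite innerDr innerNr. Qed.

Lemma inner_suml (I : Type) (s : seq I) (Q : pred I) (F : I -> H) y :
  inner (\sum_(i <- s | Q i) F i) y = \sum_(i <- s | Q i) inner (F i) y.
Proof.
elim/big_rec2: _ => [|i u v _ <-]; first exact: inner0l.
by rewrite innerDl.
Qed.

Lemma inner_sumr (I : Type) (s : seq I) (Q : pred I) (F : I -> H) y :
  inner y (\sum_(i <- s | Q i) F i) = \sum_(i <- s | Q i) inner y (F i).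
Proof. by rewrite innerC inner_suml; apply: eq_bigr => i _; rewrite innerC. Qed.

Lemma inner_extr x y : (forall z, inner x z = inner y z) -> x = y.
Proof.
move=> h; apply/eqP; rewrite -subr_eq0 -normr_eq0 -sqrf_eq0 sqr_norm_inner.
by rewrite innerBl h subrr.
Qed.

Lemma sqr_normD x y : `|x + y| ^+ 2 = `|x| ^+ 2 + 2 * inner x y + `|y| ^+ 2.
Proof. by rewrite !sqr_norm_inner !(innerDl, innerDr) (innerC y x); ring. Qed.

Lemma sqr_normB x y : `|x - y| ^+ 2 = `|x| ^+ 2 - 2 * inner x y + `|y| ^+ 2.
Proof. by rewrite sqr_normD normrN innerNr; ring. Qed.

Lemma sqr_normD_le x y : `|x + y| ^+ 2 <= 2 * (`|x| ^+ 2 + `|y| ^+ 2).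
Proof.
rewrite sqr_normD; have : 0 <= `|x - y| ^+ 2 by rewrite sqr_ge0.
by rewrite sqr_normB; lra.
Qed.

Lemma sqr_inner_le x y : inner x y ^+ 2 <= `|x| ^+ 2 * `|y| ^+ 2.
Proof.
apply: discriminant_le => [|t]; first by rewrite sqr_ge0.
have : 0 <= `|x + t *: y| ^+ 2 by rewrite sqr_ge0.
by rewrite sqr_normD innerZr normrZ exprMn real_normK ?num_real//; nra.
Qed.

Lemma normr_inner_le x y : `|inner x y| <= `|x| * `|y|.
Proof.
rewrite -(@ler_pXn2r _ 2)// ?nnegrE// ?mulr_ge0//.
by rewrite real_normK ?num_real// exprMn sqr_inner_le.
Qed.

Lemma inner_polar x y :
  inner x y = 2^-1 * (`|x + y| ^+ 2 - `|x| ^+ 2 - `|y| ^+ 2).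
Proof. by rewrite sqr_normD; field. Qed.

(** Polarization reduces joint continuity to that of addition and of the norm. *)
Lemma continuous_inner : continuous (fun z : H * H => inner z.1 z.2).
Proof.
have -> : (fun z : H * H => inner z.1 z.2) =
    fun z : H * H => 2^-1 * (`|z.1 + z.2| ^+ 2 - `|z.1| ^+ 2 - `|z.2| ^+ 2).
  by apply/funext => z; rewrite inner_polar.
move=> z.
have f1 : (fun z : H * H => z.1) x @[x --> z] --> z.1 by exact: cvg_fst.
have f2 : (fun z : H * H => z.2) x @[x --> z] --> z.2 by exact: cvg_snd.
apply: cvgMl_tmp; apply: cvgB; first apply: cvgB.
- by apply: cvgM; apply: cvg_norm; apply: cvgD.
- by apply: cvgM; apply: cvg_norm.
- by apply: cvgM; apply: cvg_norm.
Qed.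

Lemma cvg_inner (T : Type) (F : set_system T) (FF : Filter F) (f g : T -> H) x y :
  f @ F --> x -> g @ F --> y -> inner (f t) (g t) @[t --> F] --> inner x y.
Proof.
by move=> fx gy; apply: (cvg_comp2 fx gy); exact: (@continuous_inner (x, y)).
Qed.

End InnerProduct.

Section FiniteOrthonormal.
Variables (R : realType) (H : hilbertType R).
Implicit Types (x y : H) (u : nat -> H).

Definition orthonormal_upto u (J : nat) :=
  forall i j, (i < J)%N -> (j < J)%N -> inner (u i) (u j) = (i == j)%:R.

Lemma orthonormal_upto_seq u J : orthonormal_seq u -> orthonormal_upto u J.
Proof. by move=> ou i j _ _; exact: ou. Qed.

Lemma orthonormal_norm1 u J i : orthonormal_upto u J -> (i < J)%N -> `|u i| = 1.
Proof.
move=> ou iJ; have := ou i i iJ iJ; rewrite eqxx -sqr_norm_inner => /eqP.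
by rewrite sqrp_eq1// => /eqP.
Qed.

Lemma inner_orthonormal_sum u J (c : nat -> R) i :
  orthonormal_upto u J -> (i < J)%N ->
  inner (u i) (\sum_(j < J) c j *: u j) = c i.
Proof.
move=> ou iJ; rewrite inner_sumr (bigD1 (Ordinal iJ))//= innerZr ou// eqxx mulr1.
rewrite big1 ?addr0// => j ji; rewrite innerZr ou//.
suff -> : (i == j) = false by rewrite mulr0.
by apply: contraNF ji => /eqP ij; apply/eqP/val_inj.
Qed.

Lemma sqr_norm_orthonormal_sum u J (c : nat -> R) : orthonormal_upto u J ->
  `|\sum_(j < J) c j *: u j| ^+ 2 = \sum_(j < J) c j ^+ 2.
Proof.
move=> ou; rewrite sqr_norm_inner inner_suml; apply: eq_bigr => i _.
by rewrite innerZl inner_orthonormal_sum// expr2.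
Qed.

Lemma sqr_norm_proj_compl u J x : orthonormal_upto u J ->
  `|x - \sum_(j < J) inner (u j) x *: u j| ^+ 2 =
  `|x| ^+ 2 - \sum_(j < J) inner (u j) x ^+ 2.
Proof.
move=> ou; rewrite sqr_normB (sqr_norm_orthonormal_sum (fun j => inner (u j) x))//.
rewrite inner_sumr.
under [X in 2 * X]eq_bigr do rewrite innerZr (innerC x) -expr2.
by ring.
Qed.

Lemma Bessel u J x : orthonormal_upto u J ->
  \sum_(j < J) inner (u j) x ^+ 2 <= `|x| ^+ 2.
Proof. by move=> ou; rewrite -subr_ge0 -sqr_norm_proj_compl// sqr_ge0. Qed.

Lemma normr_proj_compl_le u J x : orthonormal_upto u J ->
  `|x - \sum_(j < J) inner (u j) x *: u j| <= `|x|.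
Proof.
move=> ou; rewrite -(@ler_pXn2r _ 2)// ?nnegrE// sqr_norm_proj_compl//.
by rewrite gerBl sumr_ge0// => i _; rewrite sqr_ge0.
Qed.

End FiniteOrthonormal.

Lemma CauchySchwarz_sum (R : realFieldType) (I : Type) (s : seq I) (Q : pred I)
    (a b : I -> R) :
  (\sum_(i <- s | Q i) a i * b i) ^+ 2 <=
  (\sum_(i <- s | Q i) a i ^+ 2) * (\sum_(i <- s | Q i) b i ^+ 2).
Proof.
apply: discriminant_le => [|t]; first by rewrite sumr_ge0// => i _; rewrite sqr_ge0.
rewrite mulr_sumr !mulr_suml -!big_split /= sumr_ge0// => i _.
have -> : a i ^+ 2 + 2 * (a i * b i) * t + b i ^+ 2 * t ^+ 2 = (a i + b i * t) ^+ 2.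
  by ring.
exact: sqr_ge0.
Qed.

(** * Linear maps and Hilbert-Schmidt tails *)

Section LinearMaps.
Variables (R : realType) (H H' : hilbertType R) (T : H -> H').
Hypothesis linT : linear T.

Lemma lin0 : T 0 = 0.
Proof. by have := linT (-1) 0 0; rewrite scaler0 addr0 scaleN1r addNr. Qed.

Lemma linD x y : T (x + y) = T x + T y.
Proof. by have := linT 1 x y; rewrite !scale1r. Qed.

Lemma linZ a x : T (a *: x) = a *: T x.
Proof. by have := linT a x 0; rewrite lin0 !addr0. Qed.

Lemma linN x : T (- x) = - T x.
Proof. by rewrite -scaleN1r linZ scaleN1r. Qed.

Lemma linB x y : T (x - y) = T x - T y.
Proof. by rewrite linD linN. Qed.

Lemma lin_sum (I : Type) (s : seq I) (Q : pred I) (F : I -> H) :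
  T (\sum_(i <- s | Q i) F i) = \sum_(i <- s | Q i) T (F i).
Proof.
elim/big_rec2: _ => [|i u v _ <-]; first exact: lin0.
by rewrite linD.
Qed.

Lemma linear_bounded_cvg (b : R) : (forall x, `|T x| <= b * `|x|) ->
  continuous T.
Proof.
move=> Tb x; apply/cvgrPdist_le => e e0.
have b1 : 0 < `|b| + 1 by rewrite ltr_pwDr.
have e1 : 0 < (`|b| + 1)^-1 * e by rewrite mulr_gt0// invr_gt0.
near=> y; rewrite -linB; apply: (le_trans (Tb _)).
apply: (@le_trans _ _ ((`|b| + 1) * `|x - y|)).
  by rewrite ler_wpM2r// (le_trans (ler_norm b))// lerDl.
rewrite -ler_pdivlMl//.
Unshelve. all: by end_near.
Qed.

(* Tail of a Hilbert-Schmidt series; [J = 0] is the bound of the operator norm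
   by the Hilbert-Schmidt norm. *)
Lemma hilbert_schmidt_tail (e : nat -> H) (J : nat) (c : R) :
  orthonormal_basis e -> continuous T -> 0 <= c ->
  (forall N, \sum_(J <= j < N) `|T (e j)| ^+ 2 <= c ^+ 2) ->
  forall x, `|T x - \sum_(j < J) inner (e j) x *: T (e j)| <= c * `|x|.
Proof.
move=> [oe eb] cT c0 hc x.
have cvT : T (series (fun j => inner (e j) x *: e j) N) -
    \sum_(j < J) inner (e j) x *: T (e j) @[N --> \oo] -->
    T x - \sum_(j < J) inner (e j) x *: T (e j).
  apply: cvgB; last exact: cvg_cst.
  exact: (cvg_comp _ T (eb x) (cT x)).
have {cvT} cvn := cvg_norm cvT _.
rewrite -(cvg_lim _ (cvn _))//; apply: limr_le; first by apply/cvg_ex; eexists; exact: cvn.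
near=> N; rewrite /series /= lin_sum (@big_cat_nat _ _ _ J)//=;
  last by near: N; exact: nbhs_infty_ge.
rewrite big_mkord; under eq_bigr do rewrite linZ.
rewrite addrC.
under [X in _ + X - _]eq_bigr do rewrite linZ.
rewrite addrK.
apply: (le_trans (ler_norm_sum _ _ _)).
under eq_bigr do rewrite normrZ.
rewrite -(@ler_pXn2r _ 2)// ?nnegrE//; last 2 first.
- by apply: sumr_ge0 => i _; rewrite mulr_ge0.
- by rewrite mulr_ge0.
(* One factor is a tail of the squared coordinates of [x], at most [|x|^2] by Bessel; the other is
   the tail assumed to be at most [c^2]. *)
apply: (le_trans (CauchySchwarz_sum _ _ _ _)).
rewrite exprMn [leLHS]mulrC; apply: ler_pM => //.
- by apply: sumr_ge0 => i _; rewrite sqr_ge0.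
- by apply: sumr_ge0 => i _; rewrite sqr_ge0.
under eq_bigr do rewrite real_normK ?num_real//.
have := (Bessel x (orthonormal_upto_seq oe (J:=N))); apply: le_trans.
rewrite -(big_mkord xpredT (fun j => inner (e j) x ^+ 2)).
rewrite [leRHS](@big_cat_nat _ _ _ J)//=;
  last by near: N; exact: nbhs_infty_ge.
by rewrite lerDr sumr_ge0// => i _; rewrite sqr_ge0.
Unshelve. all: by end_near.
Qed.

End LinearMaps.

(** * Positive operators of finite trace *)

Lemma nonneg_series_tail (R : realType) (f : nat -> R) (c : R) :
  (forall j, 0 <= f j) -> (forall N, \sum_(0 <= j < N) f j <= c) ->
  forall e, 0 < e -> exists J, forall N, \sum_(J <= j < N) f j <= e.
Proof.
move=> f0 fc e e0.
pose A := range (fun N => \sum_(0 <= j < N) f j).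
have supA : has_sup A.
  by split; [exists 0, 0%N; rewrite ?big_geq|exists c => _ [N _ <-]].
have [_ [J _ <-] hJ] := sup_adherent e0 supA.
exists J => N; have [NJ|JN] := leqP N J; first by rewrite big_geq// ltW.
have /ubP/(_ _ (ex_intro2 _ _ N I erefl)) := sup_upper_bound supA.
by rewrite (@big_cat_nat _ _ _ J)//= 1?ltnW//; lra.
Qed.

(** Compactness of the segment gives a cluster point, and a cluster point of an ultrafilter is a
    limit. All bounded real sequences thus converge along one and the same ultrafilter, with no
    extraction of subsequences. *)
Lemma ultra_bounded_cvg (R : realType) (I : Type) (G : set_system I)
    (a : I -> R) (r : R) : UltraFilter G -> (forall i, `|a i| <= r) ->
  exists l : R, a @ G --> l.
Proof.
move=> GU ar.
have aG : (a @ G) `[- r, r]%classic.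
  suff : G (a @^-1` `[- r, r]%classic) by [].
  by apply: filterS filterT => i _ /=; rewrite in_itv/= -ler_norml.
have [l [_ cl]] := @segment_compact R (- r) r (a @ G) _ aG.
exists l => B lB.
have [//|GC] := in_ultra_setVsetC (a @^-1` B) GU.
have GC' : (a @ G) (~` B) by [].
by have [x [nBx Bx]] := cl _ _ GC' lB.
Qed.

(* Positive symmetric operators of trace at most [c], the trace being tested on
   finite orthonormal families. *)
Record trace_le (R : realType) (H : hilbertType R) (T : H -> H) (c : R) : Prop :=
  TraceLe {
    trace_linear : linear T ;
    trace_symmetric : forall x y, inner (T x) y = inner x (T y) ;
    trace_psd : forall x, 0 <= inner (T x) x ;
    trace_bound : forall J (u : nat -> H), orthonormal_upto u J ->
      \sum_(j < J) inner (T (u j)) (u j) <= c }.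

Section TraceLe.
Variables (R : realType) (H : hilbertType R) (T : H -> H) (c : R).
Hypothesis hT : trace_le T c.
Implicit Types (x y : H) (u : nat -> H).

Let linT := trace_linear hT.

Lemma trace_le_ge0 : 0 <= c.
Proof. by have := @trace_bound _ _ _ _ hT 0 (fun=> 0); rewrite big_ord0; apply. Qed.

Lemma quad_form_le x : inner (T x) x <= c * `|x| ^+ 2.
Proof.
have [->|x0] := eqVneq x 0; first by rewrite inner0r normr0 expr0n mulr0.
have nx0 : `|x| != 0 by rewrite normr_eq0.
(* A normalized vector, as a constant sequence, is an orthonormal family of length 1. *)
have := @trace_bound _ _ _ _ hT 1 (fun=> `|x|^-1 *: x).
rewrite big_ord1 linZ// innerZl innerZr mulrA -invfM -expr2 => h.
rewrite mulrC -ler_pdivrMl ?exprn_gt0 ?normr_gt0//.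
apply: h => i j; rewrite !ltnS !leqn0 => /eqP-> /eqP->.
by rewrite eqxx innerZl innerZr -sqr_norm_inner mulrA -invfM mulVf ?sqrf_eq0.
Qed.

Lemma form_CauchySchwarz x y :
  inner (T x) y ^+ 2 <= inner (T x) x * inner (T y) y.
Proof.
apply: discriminant_le => [|t]; first exact: (trace_psd hT).
have := trace_psd hT (x + t *: y).
rewrite linD// linZ// !(innerDl, innerDr, innerZl, innerZr).
by rewrite (trace_symmetric hT y x) (innerC y); nra.
Qed.

(* Valid on invariant sets, so that it also bounds the operator off its
   leading eigenvectors. *)
Lemma sqr_norm_le_quad_form (W : set H) (M : R) :
  (forall x, W x -> W (T x)) ->
  (forall x, W x -> inner (T x) x <= M * `|x| ^+ 2) ->
  forall x, W x -> `|T x| ^+ 2 <= M * inner (T x) x.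
Proof.
move=> WT hM x Wx; have [Tx0|Tx0] := eqVneq (T x) 0.
  by rewrite Tx0 normr0 expr0n inner0l mulr0.
have p0 : 0 < `|T x| ^+ 2 by rewrite exprn_gt0// normr_gt0.
rewrite -(ler_pM2r p0) -expr2 [X in X ^+ 2 <= _]sqr_norm_inner.
(* At the pair [x], [T x] the left side is [|T x|^4], and the form at [T x] is at most [M |T x|^2],
   so one factor [|T x|^2] cancels. *)
apply: (le_trans (form_CauchySchwarz x (T x))).
rewrite mulrAC [leRHS]mulrC ler_wpM2l ?(trace_psd hT)//.
by apply/hM/WT.
Qed.

Lemma norm_le_quad_form (W : set H) (M : R) : 0 <= M ->
  (forall x, W x -> W (T x)) ->
  (forall x, W x -> inner (T x) x <= M * `|x| ^+ 2) ->
  forall x, W x -> `|T x| <= M * `|x|.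
Proof.
move=> M0 WT hM x Wx; rewrite -(@ler_pXn2r _ 2)// ?nnegrE ?mulr_ge0//.
apply: le_trans (sqr_norm_le_quad_form WT hM Wx) _.
by rewrite exprMn expr2 -mulrA ler_wpM2l// hM.
Qed.

Lemma trace_le_norm x : `|T x| <= c * `|x|.
Proof.
apply: (@norm_le_quad_form setT) => //; first exact: trace_le_ge0.
by move=> y _; exact: quad_form_le.
Qed.

Lemma trace_le_continuous : continuous T.
Proof. exact: linear_bounded_cvg trace_le_norm. Qed.

(** Since [|T u|^2 <= c <T u, u>] for every [u], a trace bound is also a Hilbert-Schmidt bound. It
    supplies the uniform approximation by finitely many coordinates that stands in for
    compactness. *)
Lemma trace_le_hilbert_schmidt u J : orthonormal_upto u J ->
  \sum_(0 <= j < J) `|T (u j)| ^+ 2 <= c ^+ 2.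
Proof.
move=> ou; rewrite big_mkord expr2.
apply: (@le_trans _ _ (\sum_(j < J) c * inner (T (u j)) (u j))).
  apply: ler_sum => j _.
  by apply: (@sqr_norm_le_quad_form setT) => // y _; exact: quad_form_le.
by rewrite -mulr_sumr ler_wpM2l ?trace_le_ge0// (trace_bound hT).
Qed.

(* Compactness of [T] enters through an ultrafilter on the indices of a
   maximizing sequence: the coordinates in the basis [e] converge along it, and
   [T] is uniformly close to finitely many coordinates. *)
Lemma exists_top_eigenvector (e : nat -> H) (W : set H) (M : R) :
  orthonormal_basis e -> closed W -> (forall x, W x -> W (T x)) -> 0 < M ->
  (forall x, W x -> inner (T x) x <= M * `|x| ^+ 2) ->
  (forall d, 0 < d -> exists x, [/\ W x, `|x| <= 1 & M - d < inner (T x) x]) ->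
  exists x, [/\ W x, x != 0 & T x = M *: x].
Proof.
move=> be cW WT M0 hM hsup.
have [x hx] : exists x : nat -> H, forall n,
    [/\ W (x n), `|x n| <= 1 & M - n.+1%:R^-1 < inner (T (x n)) (x n)].
  have h n : exists y, [/\ W y, `|y| <= 1 & M - n.+1%:R^-1 < inner (T y) y].
    by apply: hsup; rewrite invr_gt0 ltr0n.
  by exists (fun n => sval (cid (h n))) => n; case: cid.
have [G [GU ooG]] := @ultraFilterLemma _ (\oo : set_system nat) _.
have xW n : W (x n) by case: (hx n).
have x1 n : `|x n| <= 1 by case: (hx n).
have xM n : inner (T (x n)) (x n) <= M.
  apply: (le_trans (hM _ (xW n))); rewrite ger_pMr//.
  by rewrite expr_le1.
have cvM : inner (T (x n)) (x n) @[n --> G] --> M.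
  apply: cvg_trans (_ : inner (T (x n)) (x n) @[n --> \oo] --> M) => //.
    by move=> A /=; exact: ooG.
  apply: (@squeeze_cvgr _ _ _ _ (fun n => M - n.+1%:R^-1) (fun=> M)).
  - by near=> n; rewrite xM andbT ltW//; case: (hx n).
  - rewrite -[X in _ --> X]subr0; apply: cvgB; first exact: cvg_cst.
    exact: cvg_harmonic.
  - exact: cvg_cst.
have cauT : cauchy (T (x n) @[n --> G]).
  apply/cauchy_exP => d d0.
  have d4 : 0 < d / 4 by rewrite divr_gt0.
  (* Beyond [J] the operator contributes at most [d / 4]; the remaining finite sum converges along
     [G] because each of its bounded coordinates does. *)
  have [J hJ] := nonneg_series_tail (fun j => sqr_ge0 `|T (e j)|)
    (fun N => trace_le_hilbert_schmidt (orthonormal_upto_seq be.1 (J:=N)))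
    (exprn_gt0 2 d4).
  have tail := hilbert_schmidt_tail linT be trace_le_continuous (ltW d4) hJ.
  have [z hz] : exists z : H, \sum_(j < J) inner (e j) (x n) *: T (e j)
      @[n --> G] --> z.
    have h (j : 'I_J) : exists l : R, inner (e j) (x n) @[n --> G] --> l.
      apply: (@ultra_bounded_cvg _ _ _ _ 1) => n.
      apply: (le_trans (normr_inner_le _ _)).
      by rewrite (orthonormal_norm1 (orthonormal_upto_seq be.1 (J:=J)))// mul1r.
    exists (\sum_(j < J) sval (cid (h j)) *: T (e j)).
    apply: cvg_big => [|j _]; first exact: add_continuous.
    by apply: cvgZr_tmp; case: cid.
  exists z; rewrite /= -ball_normE.
  move/cvgrPdist_lt : hz => /(_ _ d4) hz.
  apply: filterS hz => n /= hz.
  have := tail (x n); rewrite distrC => tn.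
  have tn1 : d / 4 * `|x n| <= d / 4 by rewrite ger_pMr.
  have := ler_distD (\sum_(j < J) inner (e j) (x n) *: T (e j)) z (T (x n)).
  by lra.
have /cauchy_cvg/cvg_ex[z hz] := cauT.
pose y := M^-1 *: z.
have cvx : x @ G --> y.
  (* [T (x n)] converges and [T (x n) - M *: x n] tends to 0, so the maximizing sequence itself
     converges in norm. The division requires [M > 0]. *)
  have -> : x = (fun n => M^-1 *: (T (x n) - (T (x n) - M *: x n))).
    by apply/funext => n; rewrite opprB addrC subrK scalerA mulVf ?gt_eqF ?scale1r.
  rewrite /y -[z]subr0; apply: cvgZl_tmp; apply: cvgB => //.
  apply: norm_cvg0.
  (* With [q = <T x, x>], the bounds [|T x|^2 <= M q] and [|x| <= 1] leave at most
     [M q - 2 M q + M^2] after expanding the square. *)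
  have h n : `|T (x n) - M *: x n| ^+ 2 <= M * (M - inner (T (x n)) (x n)).
    rewrite sqr_normB innerZr normrZ exprMn real_normK ?num_real//.
    have := sqr_norm_le_quad_form WT hM (xW n).
    have : M ^+ 2 * `|x n| ^+ 2 <= M ^+ 2 by rewrite ger_pMr ?exprn_gt0// expr_le1.
    by lra.
  have h2 : `|T (x n) - M *: x n| ^+ 2 @[n --> G] --> 0.
    apply: (@squeeze_cvgr _ _ _ _ (fun=> 0) (fun n => M * (M - inner (T (x n)) (x n)))).
    - by near=> n; rewrite h sqr_ge0.
    - exact: cvg_cst.
    - rewrite -[X in _ --> X](mulr0 M) -(subrr M); apply: cvgMl_tmp.
      by apply: cvgB => //; exact: cvg_cst.
  apply/cvgr0Pnorm_lt => d d0.
  move/cvgr0Pnorm_lt : h2 => /(_ _ (exprn_gt0 2 d0)).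
  apply: filterS => n; rewrite normr_id normrX normr_id.
  by rewrite ltr_pXn2r// ?nnegrE// ltW.
have Ty : T y = z.
  by apply: (cvg_unique _ (cvg_comp _ T cvx (trace_le_continuous (x:=y))) hz).
have qy : inner (T y) y = M.
  rewrite Ty; exact: (cvg_unique _ (cvg_inner _ hz cvx) cvM).
exists y; split.
- have Wn : \forall n \near G, W (x n) by near=> n.
  exact: (closed_cvg W cW Wn _ cvx).
- by apply: contraTneq M0 => y0; rewrite -qy y0 inner0r ltxx.
- by rewrite Ty /y scalerA mulfV ?gt_eqF// scale1r.
Unshelve. all: by end_near.
Qed.

End TraceLe.

(** * Variational bounds and perturbation of eigenvalues *)

Section Eigensystem.
Variables (R : realType) (H : hilbertType R) (e : nat -> H).
Hypothesis be : orthonormal_basis e.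

Definition leading_compl (v : nat -> H) (j : nat) : set H :=
  [set x | forall i, (0 < i <= j)%N -> inner (v i) x = 0].

Lemma closed_leading_compl v j : closed (leading_compl v j).
Proof.
have -> : leading_compl v j =
    \bigcap_(i in [set i | (0 < i <= j)%N]) ((inner (v i)) @^-1` [set 0]).
  by apply/seteqP; split => x hx i /hx.
apply: closed_bigI => i _; apply: closed_comp; last exact: closed_eq.
move=> x _; apply: (@cvg_inner _ _ _ _ _ (fun=> v i) id); last exact: cvg_id.
exact: cvg_cst.
Qed.

Variables (T : H -> H) (c : R) (lam : nat -> R) (v : nat -> H).
Hypotheses (hT : trace_le T c) (hv : eigensystem T lam v).

Lemma eigen_orthonormal : orthonormal_seq (fun j => v j.+1).
Proof. by case: hv. Qed.

Lemma eigen_eq j : (0 < j)%N -> T (v j) = lam j *: v j.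
Proof. by case: hv => _ h _ _ _; exact: h. Qed.

Lemma eigen_ge0 j : (0 < j)%N -> 0 <= lam j.
Proof. by case: hv => _ _ h _ _; exact: h. Qed.

Lemma eigen_anti i j : (0 < i <= j)%N -> lam j <= lam i.
Proof. by case: hv => _ _ _ h _; exact: h. Qed.

Lemma leading_compl_stable j x : leading_compl v j x -> leading_compl v j (T x).
Proof.
move=> Wx i /[dup] /Wx xi /andP[i0 _].
by rewrite -(trace_symmetric hT) eigen_eq// innerZl xi mulr0.
Qed.

(** Let [M] be the supremum of the form over the unit ball of the complement. If positive, it is an
    eigenvalue with an eigenvector in the complement, and the completeness clause of the eigensystem
    makes that vector a combination of the [v i] with [lam i = M]. Were [M] above [lam j.+1], only
    indices [i <= j] could occur, and there the coordinates vanish. *)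
Lemma quad_form_le_eigen j x : leading_compl v j x ->
  inner (T x) x <= lam j.+1 * `|x| ^+ 2.
Proof.
pose W := leading_compl v j.
pose A := [set inner (T x) x | x in [set x | W x /\ `|x| <= 1]].
have A0 : A 0.
  exists 0; last by rewrite inner0r.
  by split => [i _|]; rewrite ?inner0r ?normr0.
have supA : has_sup A.
  split; first by exists 0.
  exists c => _ [y [_ y1] <-]; apply: (le_trans (quad_form_le hT y)).
  by rewrite ler_piMr ?(trace_le_ge0 hT)// expr_le1.
pose M := sup A.
have hM y : W y -> inner (T y) y <= M * `|y| ^+ 2.
  move=> Wy; have [->|y0] := eqVneq y 0.
    by rewrite inner0r normr0 expr0n mulr0.
  have ny0 : 0 < `|y| by rewrite normr_gt0.
  have Aq : A (`|y| ^- 2 * inner (T y) y).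
    exists (`|y|^-1 *: y); last first.
      rewrite (linZ (trace_linear hT)).
      by rewrite innerZl innerZr mulrA -invfM -expr2.
    split; first by move=> i /Wy yi; rewrite innerZr yi mulr0.
    by rewrite normrZ normfV normr_id mulVf ?gt_eqF.
  have /ubP/(_ _ Aq) := sup_upper_bound supA.
  by rewrite ler_pdivrMl ?exprn_gt0// mulrC.
suff Ml : M <= lam j.+1.
  by move=> /hM h; apply: (le_trans h); rewrite ler_wpM2r.
have [M0|M0] := leP M 0; first exact: le_trans M0 (eigen_ge0 _).
have [z [Wz z0 Tz]] : exists z, [/\ W z, z != 0 & T z = M *: z].
  apply: (exists_top_eigenvector hT be) => //.
  - exact: closed_leading_compl.
  - exact: leading_compl_stable.
  - move=> d d0; have [_ [y [Wy y1] <-] hy] := sup_adherent d0 supA.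
    by exists y.
rewrite leNgt; apply/negP => lM.
have [_ _ _ _ /(_ M z (lt0r_neq0 M0) Tz)[N zN]] := hv.
move/negP : z0; apply; rewrite zN big_nat_cond big1// => i /andP[/andP[i1 _]] /eqP li.
suff ij : (i <= j)%N by rewrite Wz ?i1// scale0r.
rewrite leqNgt; apply/negP => ji.
by have := @eigen_anti j.+1 i ji; rewrite li leNgt lM.
Qed.

Lemma norm_le_eigen j x : leading_compl v j x -> `|T x| <= lam j.+1 * `|x|.
Proof.
move=> Wx; apply: (norm_le_quad_form hT (W:=leading_compl v j)) => //.
- exact: eigen_ge0.
- exact: leading_compl_stable.
- exact: quad_form_le_eigen.
Qed.

(** The first [j] eigenvalues are all at least [lam j], and the trace bound controls their sum. This
    explicit decay bounds the truncation level and yields a rank at which the eigenvalue is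
    small. *)
Lemma eigen_le_trace j : (0 < j)%N -> j%:R * lam j <= c.
Proof.
move=> j0.
apply: le_trans (trace_bound hT (orthonormal_upto_seq eigen_orthonormal (J:=j))).
rewrite mulr_natl -[X in _ *+ X](card_ord j) -sumr_const; apply: ler_sum => i _.
rewrite eigen_eq// innerZl (eigen_orthonormal i i) eqxx mulr1.
by apply: eigen_anti; rewrite /= ltn_ord.
Qed.

Lemma quad_form_eigen_sum J (a : nat -> R) :
  let x := \sum_(i < J) a i *: v i.+1 in
  inner (T x) x = \sum_(i < J) lam i.+1 * a i ^+ 2.
Proof.
move=> x; rewrite (lin_sum (trace_linear hT)).
rewrite inner_suml; apply: eq_bigr => i _.
rewrite (linZ (trace_linear hT)).
rewrite eigen_eq// !innerZl.
rewrite (inner_orthonormal_sum a (orthonormal_upto_seq eigen_orthonormal (J:=J)))//.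
by ring.
Qed.

End Eigensystem.

(** Dimension count: some nonzero combination of the first [k + 1] eigenvectors of [T] is orthogonal
    to the first [k] eigenvectors of [T']. There the form of [T] is at least [lam k.+1] and that of
    [T'] at most [lam' k.+1]. A one-sided comparison of forms suffices; exchanging the operators
    gives the other direction. *)
Lemma eigenvalue_perturbation (R : realType) (H : hilbertType R) (e : nat -> H)
    (T T' : H -> H) (c c' eta : R) (lam lam' : nat -> R) (v v' : nat -> H) :
  orthonormal_basis e -> trace_le T c -> trace_le T' c' ->
  eigensystem T lam v -> eigensystem T' lam' v' ->
  (forall x, inner (T x) x <= inner (T' x) x + eta * `|x| ^+ 2) ->
  forall j, (0 < j)%N -> lam j <= lam' j + eta.
Proof.
move=> be hT hT' hv hv' hTT' [//|k] _.
pose A := \matrix_(i < k.+1, l < k) inner (v' l.+1) (v i.+1).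
have : kermx A != 0.
  rewrite -mxrank_eq0 mxrank_ker -lt0n subn_gt0.
  exact: leq_ltn_trans (rank_leq_col A) _.
move=> /rowV0Pn[a /sub_kermxP aA a0].
(* The lemmas on orthonormal sums take coefficients indexed by [nat]; the default 0 lies outside the
   summation range. *)
pose b i := if insub i is Some i' then a 0 (i' : 'I_k.+1) else 0.
have bE (i : 'I_k.+1) : b i = a 0 i by rewrite /b valK.
pose x := \sum_(i < k.+1) b i *: v i.+1.
have ou := orthonormal_upto_seq (eigen_orthonormal hv) (J:=k.+1).
have nx : `|x| ^+ 2 = \sum_(i < k.+1) b i ^+ 2.
  exact: (sqr_norm_orthonormal_sum b ou).
have x0 : 0 < `|x| ^+ 2.
  have [i ai] : exists i, a 0 i != 0 by apply/rV0Pn.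
  rewrite nx (bigD1 i)//= ltr_pwDl//; last by rewrite sumr_ge0// => l _; rewrite sqr_ge0.
  by rewrite bE exprn_even_gt0.
have Wx : leading_compl v' k x.
  move=> [//|l] lk; have := congr1 (fun m : 'rV_k => m 0 (Ordinal lk)) aA.
  rewrite !mxE => <-; rewrite inner_sumr; apply: eq_bigr => i _.
  by rewrite innerZr bE mxE.
rewrite -(ler_pM2r x0) mulrDl.
apply: (@le_trans _ _ (inner (T x) x)).
  rewrite (quad_form_eigen_sum hT hv) nx mulr_sumr; apply: ler_sum => i _.
  by rewrite ler_wpM2r ?sqr_ge0//; apply: (eigen_anti hv); rewrite /= ltn_ord.
apply: (le_trans (hTT' x)); rewrite lerD2r.
exact: (quad_form_le_eigen be hT' hv').
Qed.

(** * Maxima of index sets and the truncation level *)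

Section MaxSet.
Implicit Types A : set nat.

(** 0 is also the value on empty and on unbounded sets, so membership follows only from a positive
    maximum. *)
Lemma max_set_mem A : (0 < max_set A)%N -> A (max_set A).
Proof. by rewrite /max_set; case: xgetP => // k -> [Ak _]. Qed.

Lemma max_set_ge A (N k : nat) : (forall j, A j -> (j <= N)%N) -> A k ->
  (k <= max_set A)%N.
Proof.
move=> AN Ak; rewrite /max_set; case: xgetP => [j -> [_ jA]|]; first exact: jA.
have exA : exists j, `[< A j >] by exists k; apply/asboolP.
have ubA j : `[< A j >] -> (j <= N)%N by move=> /asboolP; exact: AN.
case: (ex_maxnP exA ubA) => j /asboolP Aj jA /(_ j); case; split => // i Ai.
by apply/jA/asboolP.
Qed.

End MaxSet.

Section TruncationLevel.
Variables (R : realType) (H : hilbertType R) (e : nat -> H) (T : H -> H) (c : R).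
Variables (lam : nat -> R) (v : nat -> H) (m : R).
Hypotheses (be : orthonormal_basis e) (hT : trace_le T c).
Hypotheses (hv : eigensystem T lam v) (m0 : 0 < m).

Lemma inve_le_EFin (a : R) : 0 <= a -> (a%:E^-1 <= m%:E)%E = (m^-1 <= a).
Proof.
rewrite le_eqVlt => /predU1P[<-|a0].
  by rewrite inve0 leye_eq/= leNgt invr_gt0 m0.
by rewrite inver gt_eqF// lee_fin invf_ple.
Qed.

Lemma gap_ge0 j : (0 < j)%N -> 0 <= gap lam j.
Proof.
rewrite /gap; case: eqP => [_ _|/eqP j1 j0].
  by rewrite subr_ge0; apply: (eigen_anti hv).
rewrite le_min !subr_ge0; apply/andP; split; apply: (eigen_anti hv).
  by case: j j0 j1 => [|[|j]]//= _ _; exact: leqnSn.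
by rewrite j0 leqnSn.
Qed.

Lemma gap_le j : (0 < j)%N -> gap lam j <= lam j.
Proof.
rewrite /gap; case: eqP => [-> _|_ j0].
  by rewrite gerBl (eigen_ge0 hv).
by rewrite ge_min gerBl (eigen_ge0 hv)// orbT.
Qed.

(** By [j * lam j <= c], the sets whose maxima define [Bn] and [En] are bounded; otherwise the
    maxima would fall back to 0. *)
Lemma Bn_bound j : (0 < j)%N -> m^-1 <= lam j -> (j <= Num.truncn (c * m))%N.
Proof.
move=> j0 mj; have jc := eigen_le_trace hT hv j0.
have cm0 : 0 <= c * m by rewrite mulr_ge0 ?(trace_le_ge0 hT)// ltW.
rewrite truncn_ge_nat// -ler_pdivrMr//; apply: le_trans jc.
by rewrite ler_wpM2l.
Qed.

Lemma Kn_le : [/\ (Kn lam m <= Bn lam m)%N, (Kn lam m <= En lam m)%N &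
  (Kn lam m)%:R <= m].
Proof.
have h : (Kn lam m)%:R <= Num.min (Num.min (Bn lam m)%:R (En lam m)%:R) m :> R.
  by rewrite /Kn truncn_le !le_min !ler0n ltW.
move: h; rewrite !le_min => /andP[/andP[h1 h2] h3].
by split => //; rewrite -(ler_nat R).
Qed.

Lemma Kn_eigenvalue j : (0 < j <= Kn lam m)%N -> m^-1 <= lam j.
Proof.
move=> /andP[j0 jK]; have [KB _ _] := Kn_le.
have jB := leq_trans jK KB.
have [] := max_set_mem (leq_trans j0 jB).
rewrite -/(Bn _ _) => B0; rewrite inve_le_EFin ?(eigen_ge0 hv)// => h.
by apply: (le_trans h); apply: (eigen_anti hv); rewrite j0.
Qed.

Lemma Kn_ge L : (0 < L)%N -> L%:R <= m -> m^-1 <= lam L ->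
  (forall j, (0 < j <= L)%N -> m^-1 <= gap lam j) -> (L <= Kn lam m)%N.
Proof.
move=> L0 Lm mL mg.
have min0 : 0 <= Num.min (Num.min (Bn lam m)%:R (En lam m)%:R) m.
  by rewrite !le_min !ler0n ltW.
rewrite /Kn truncn_ge_nat// !le_min Lm andbT !ler_nat.
apply/andP; split.
- apply: (@max_set_ge _ (Num.truncn (c * m))).
    move=> j [j0]; rewrite inve_le_EFin ?(eigen_ge0 hv)//; exact: Bn_bound.
  by split => //; rewrite inve_le_EFin ?(eigen_ge0 hv).
- apply: (@max_set_ge _ (Num.truncn (c * m))).
    move=> j [j0]; rewrite big_nat_recr//= ge_max => /andP[_].
    rewrite inve_le_EFin ?gap_ge0// => h.
    (* A gap is at most its eigenvalue, so the bound for [Bn] also covers [En]. *)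
    by apply: Bn_bound => //; exact: (le_trans h (gap_le _)).
  split => //; rewrite big_nat_cond; apply: (big_ind (fun x => x <= m%:E)%E) => //.
  + by rewrite leNye.
  + by move=> x y; rewrite ge_max => -> ->.
  + move=> j; rewrite andbT ltnS => /[dup] jL /andP[j0 _].
    by rewrite inve_le_EFin ?gap_ge0// mg.
Qed.

End TruncationLevel.

(** * Projection off the leading eigenvectors *)

Section EigenProjection.
Variables (R : realType) (H : hilbertType R) (e : nat -> H) (T : H -> H) (c : R).
Variables (lam : nat -> R) (v : nat -> H).
Hypotheses (be : orthonormal_basis e) (hT : trace_le T c).
Hypotheses (hv : eigensystem T lam v).

Definition proj_compl K (x : H) := x - \sum_(1 <= j < K.+1) inner (v j) x *: v j.

Let ou K := orthonormal_upto_seq (eigen_orthonormal hv) (J:=K).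

Lemma proj_complE K x :
  proj_compl K x = x - \sum_(j < K) inner (v j.+1) x *: v j.+1.
Proof. by rewrite /proj_compl big_add1 big_mkord. Qed.

Lemma proj_compl_norm K x : `|proj_compl K x| <= `|x|.
Proof. by rewrite proj_complE; exact: (normr_proj_compl_le x (@ou K)). Qed.

Lemma proj_complB K x y : proj_compl K (x - y) = proj_compl K x - proj_compl K y.
Proof.
rewrite /proj_compl; under eq_bigr do rewrite innerBr scalerBl.
by rewrite sumrB !opprB addrACA [RHS]addrACA [- y + _]addrC.
Qed.

Lemma proj_compl_sym K x y : inner (proj_compl K x) y = inner x (proj_compl K y).
Proof.
rewrite /proj_compl innerBl innerBr inner_suml inner_sumr; congr (_ - _).
by apply: eq_bigr => j _; rewrite innerZl innerZr mulrC (innerC x).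
Qed.

Lemma proj_compl_leading K x : leading_compl v K (proj_compl K x).
Proof.
move=> [//|i] iK; rewrite proj_complE innerBr.
rewrite (inner_orthonormal_sum (fun j => inner (v j.+1) x) (@ou K))//.
by rewrite subrr.
Qed.

Lemma proj_compl_comm K x : proj_compl K (T x) = T (proj_compl K x).
Proof.
rewrite /proj_compl (linB (trace_linear hT)).
rewrite (lin_sum (trace_linear hT)).
congr (_ - _); rewrite !big_add1 /=; apply: eq_bigr => j _.
rewrite (linZ (trace_linear hT)).
by rewrite -(trace_symmetric hT) (eigen_eq hv)// innerZl scalerA mulrC.
Qed.

Lemma proj_compl_image_le K x : `|proj_compl K (T x)| <= lam K.+1 * `|x|.
Proof.
rewrite proj_compl_comm; apply: (le_trans (norm_le_eigen be hT hv _)).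
  exact: proj_compl_leading.
by rewrite ler_wpM2l ?(eigen_ge0 hv)// proj_compl_norm.
Qed.

(* The estimator reproduces [Psi] on the span of the leading [K] eigenvectors;
   off it, only the noise part [E] of [Delta] remains. *)
Lemma Psi_hat_error (H' : hilbertType R) (Psi E Delta : H -> H') K (m b : R) x :
  linear Psi -> linear E -> (forall x, Delta x = Psi (T x) + E x) ->
  0 < m -> (forall x, `|E x| <= b * `|x|) ->
  (forall j, (0 < j <= K)%N -> m^-1 <= lam j) ->
  `|Psi_hat Delta lam v K x - Psi x| <= `|Psi (proj_compl K x)| + b * m * `|x|.
Proof.
move=> linPsi linE hD m0 hE hm.
have [->|x0] := eqVneq x 0.
  rewrite /Psi_hat big1 => [|j _]; last by rewrite inner0r scale0r.
  rewrite (lin0 linPsi) subr0 !normr0 mulr0 addr0.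
  exact: normr_ge0.
have b0 : 0 <= b.
  have := le_trans (normr_ge0 _) (hE x).
  by rewrite pmulr_lge0// normr_gt0.
(* [y] is the truncated inverse of [T] applied to [x]: [Delta y] is the estimator at [x], while
   [T y] is the projection of [x] on the leading eigenvectors. As the inverse eigenvalues are at
   most [m], Bessel gives [|y| <= m |x|]. *)
pose y := \sum_(j < K) ((lam j.+1)^-1 * inner (v j.+1) x) *: v j.+1.
have -> : Psi_hat Delta lam v K x - Psi x = - Psi (proj_compl K x) + E y.
  rewrite proj_complE (linB linPsi) opprB addrAC; congr (_ - _).
  rewrite /y (lin_sum linPsi) (lin_sum linE) /Psi_hat big_add1 big_mkord /=.
  rewrite -big_split; apply: eq_bigr => j _ /=.
  rewrite hD (eigen_eq hv)// !(linZ linPsi) (linZ linE) scalerDr scalerA mulVf.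
    by rewrite scale1r scalerDr !scalerA [in RHS](mulrC (lam j.+1)^-1).
  by rewrite gt_eqF// (lt_le_trans _ (hm _ _)) ?invr_gt0//= ltn_ord.
apply: (le_trans (ler_normD _ _)); rewrite normrN lerD2l.
apply: (le_trans (hE _)); rewrite -mulrA ler_wpM2l//.
have mx0 : 0 <= m * `|x| by rewrite mulr_ge0// ltW.
rewrite -(@ler_pXn2r _ 2)// ?nnegrE//.
rewrite (sqr_norm_orthonormal_sum (fun j => (lam j.+1)^-1 * inner (v j.+1) x) (@ou K)).
rewrite exprMn.
have h := ler_wpM2l (exprn_ge0 2 (ltW m0)) (Bessel x (@ou K)).
apply: (le_trans _ h).
rewrite mulr_sumr; apply: ler_sum => j _.
rewrite exprMn ler_wpM2r ?sqr_ge0//.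
rewrite ler_pXn2r// ?nnegrE ?invr_ge0 ?(eigen_ge0 hv)// ?(ltW m0)//.
have lj : m^-1 <= lam j.+1 by apply: hm; rewrite /= ltn_ord.
by rewrite invf_ple ?posrE// (lt_le_trans _ lj)// invr_gt0.
Qed.

End EigenProjection.

Lemma finite_pos_lbound (R : realFieldType) (n : nat) (f : nat -> R) :
  (forall j, (j < n)%N -> 0 < f j) ->
  exists2 g, 0 < g & forall j, (j < n)%N -> g <= f j.
Proof.
elim: n => [|n IH] h; first by exists 1.
have [|g g0 hg] := IH; first by move=> j jn; apply: h; exact: ltnW.
exists (Num.min g (f n)); first by rewrite lt_min g0 h.
move=> j; rewrite ltnS leq_eqVlt => /predU1P[->|jn].
  by rewrite ge_min lexx orbT.
by rewrite ge_min hg.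
Qed.

(** * Deterministic consistency *)

Section Consistency.
Variables (R : realType) (H1 H2 : hilbertType R) (e : nat -> H1).
Variables (C : H1 -> H1) (c : R) (lam : nat -> R) (v : nat -> H1).
Hypotheses (be : orthonormal_basis e) (hC : trace_le C c).
Hypotheses (hv : eigensystem C lam v) (dC : closure (range C) = setT).

(* The projection off the leading empirical eigenvectors is small at a vector
   [C z], hence, by density of the range, at each [e j]. *)
Lemma small_off_leading (Psi : H1 -> H2) (b : R) :
  linear Psi -> continuous Psi ->
  (forall N, \sum_(0 <= j < N) `|Psi (e j)| ^+ 2 <= b) ->
  forall eps, 0 < eps -> exists2 eta, 0 < eta &
  exists L, (0 < L)%N /\ forall (T : H1 -> H1) c' mu u K,
    trace_le T c' -> eigensystem T mu u ->
    (forall x, `|T x - C x| <= eta * `|x|) -> (L <= K)%N ->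
    forall x, `|x| <= 1 -> `|Psi (proj_compl u K x)| <= eps.
Proof.
move=> linPsi cPsi Psib eps eps0.
have eps2 : 0 < eps / 2 by rewrite divr_gt0.
have [J hJ] := nonneg_series_tail (fun j => sqr_ge0 `|Psi (e j)|) Psib (exprn_gt0 2 eps2).
have tail := hilbert_schmidt_tail linPsi be cPsi (ltW eps2) hJ.
pose S := \sum_(j < J) `|Psi (e j)| + 1.
have S0 : 0 < S by rewrite ltr_wpDl// sumr_ge0.
(* Coordinates of size [2 * d] weighted by [|Psi (e j)|] add up to at most [2 * d * S = eps / 2],
   the other half being the tail. The [+ 1] in [S], as in [Z] below, secures positivity. *)
pose d := eps / (4 * S).
have d0 : 0 < d by rewrite divr_gt0// mulr_gt0.
have [z hz] : exists z : nat -> H1, forall j, `|e j - C (z j)| < d.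
  have h j : exists y, `|e j - C y| < d.
    have : closure (range C) (e j) by rewrite dC.
    move=> /(_ _ (nbhsx_ballx _ _ d0))[_ [[y _ <-]]].
    by rewrite -ball_normE /= => hy; exists y.
  by exists (fun j => sval (cid (h j))) => j; case: cid.
pose Z := \sum_(j < J) `|z j| + 1.
have Z0 : 0 < Z by rewrite ltr_wpDl// sumr_ge0.
have zZ j : (j < J)%N -> `|z j| <= Z.
  move=> jJ; rewrite /Z (bigD1 (Ordinal jJ))//= -addrA lerDl addr_ge0//.
  by rewrite sumr_ge0.
(* At [z j] two errors arise, [2 * eta * |z j|] from the eigenvalue of index [K + 1] and
   [eta * |z j|] from replacing [C] by [T]; together they must not exceed [d]. *)
pose eta := d / (3 * Z).
have eta0 : 0 < eta by rewrite divr_gt0// mulr_gt0.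
exists eta => //.
have c0 := trace_le_ge0 hC.
(* [L > c / eta] forces [lam L <= eta], because [L * lam L <= c]. *)
pose L := (Num.truncn (c / eta)).+1.
exists L; split=> // T c' mu u K hT hu hTC LK x x1.
have lamL : lam L <= eta.
  have h := eigen_le_trace hC hv (isT : (0 < L)%N).
  have : c < L%:R * eta.
    by rewrite -ltr_pdivrMr// truncnS_gt.
  move=> /(le_lt_trans h); rewrite ltr_pM2l ?ltr0n//; exact: ltW.
have muK : mu K.+1 <= 2 * eta.
  apply: (@le_trans _ _ (mu L)).
    by apply: (eigen_anti hu); rewrite ltnS; exact: leqW.
  apply: (@le_trans _ _ (lam L + eta)); last by lra.
  apply: (eigenvalue_perturbation be hT hC hu hv) => // y.
  rewrite -lerBlDl -innerBl; apply: (le_trans (ler_norm _)).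
  apply: (le_trans (normr_inner_le _ _)).
  by rewrite expr2 mulrA ler_wpM2r.
pose Q := proj_compl u K.
have Qe j : (j < J)%N -> `|Q (e j)| <= 2 * d.
  move=> jJ.
  have -> : Q (e j) = Q (e j - C (z j)) + (Q (T (z j)) - Q (T (z j) - C (z j))).
    by rewrite /Q !proj_complB subKr subrK.
  apply: (le_trans (ler_normD _ _)).
  have h1 : `|Q (e j - C (z j))| <= d.
    exact: (le_trans (proj_compl_norm hu K _) (ltW (hz j))).
  have h2 : `|Q (T (z j))| <= 2 * eta * `|z j|.
    by apply: (le_trans (proj_compl_image_le be hT hu K _)); rewrite ler_wpM2r.
  have h3 : `|Q (T (z j) - C (z j))| <= eta * `|z j|.
    exact: (le_trans (proj_compl_norm hu K _) (hTC _)).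
  have h4 := ler_normB (Q (T (z j))) (Q (T (z j) - C (z j))).
  have h5 : 3 * eta * `|z j| <= d.
    apply: (@le_trans _ _ (3 * eta * Z)).
      by rewrite ler_wpM2l ?zZ// mulr_ge0// ltW.
    by rewrite /eta le_eqVlt; apply/orP; left; apply/eqP; field; rewrite gt_eqF.
  by lra.
have Qx1 : `|Q x| <= 1 by exact: (le_trans (proj_compl_norm hu K _) x1).
have t := tail (Q x).
have t2 : `|\sum_(j < J) inner (e j) (Q x) *: Psi (e j)| <= 2 * d * S.
  apply: (le_trans (ler_norm_sum _ _ _)).
  apply: (@le_trans _ _ (\sum_(j < J) 2 * d * `|Psi (e j)|)); last first.
    rewrite -mulr_sumr; apply: ler_wpM2l; last by rewrite lerDl.
    by rewrite mulr_ge0// ltW.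
  apply: ler_sum => j _; rewrite normrZ ler_wpM2r//.
  (* Symmetry moves [Q] from [x] to [e j]: smallness at finitely many basis vectors becomes uniform
     over the unit ball. *)
  rewrite -(proj_compl_sym u K); apply: (le_trans (normr_inner_le _ _)).
  apply: (@le_trans _ _ `|Q (e j)|); last exact: Qe.
  by rewrite ler_piMr.
have dS : 2 * d * S = eps / 2 by rewrite /d; field; rewrite gt_eqF.
rewrite -/Q -[Psi (Q x)](subrK (\sum_(j < J) inner (e j) (Q x) *: Psi (e j))).
apply: (le_trans (ler_normD _ _)).
have t3 : eps / 2 * `|Q x| <= eps / 2 by rewrite ler_piMr// ltW.
by lra.
Qed.

Lemma Kn_large (L : nat) : (0 < L)%N ->
  (forall i j, (0 < i)%N -> (0 < j)%N -> i <> j -> lam i <> lam j) ->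
  exists2 eta, 0 < eta & exists m0, forall (T : H1 -> H1) c' mu u m,
    trace_le T c' -> eigensystem T mu u ->
    (forall x, `|T x - C x| <= eta * `|x|) -> m0 <= m -> (L <= Kn mu m)%N.
Proof.
move=> L0 lamD.
have lam_lt i : (0 < i)%N -> lam i.+1 < lam i.
  move=> i0; rewrite lt_neqAle (eigen_anti hv) ?i0 ?leqnSn// andbT.
  by apply/eqP/lamD => //; apply/eqP; rewrite eqn_leq ltnn.
have gap_gt0 j : (0 < j)%N -> 0 < gap lam j.
  move=> j0; rewrite /gap; case: eqP => [_|j1].
    by rewrite subr_gt0 lam_lt.
  rewrite lt_min !subr_gt0 lam_lt// andbT.
  by case: j j0 j1 => [|[|j]]//= _ _; rewrite lam_lt.
have [g g0 hg] : exists2 g, 0 < g & forall j, (j < L)%N -> g <= gap lam j.+1.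
  by apply: (@finite_pos_lbound _ _ (fun j => gap lam j.+1)) => j _; exact: gap_gt0.
have eta0 : 0 < g / 4 by rewrite divr_gt0.
(* Eigenvalues then move by at most [g / 4] and gaps by at most [g / 2]; [m >= 2 / g] makes the
   remaining [g / 2] at least [m^-1]. *)
exists (g / 4) => //.
exists (Num.max (2 / g) L%:R) => T c' mu u m hT hu hTC.
rewrite ge_max => /andP[gm Lm].
have m0 : 0 < m by apply: lt_le_trans gm; rewrite divr_gt0.
have mg : m^-1 <= g / 2 by rewrite invf_ple ?posrE ?divr_gt0// invf_div.
have close x : `|inner (T x - C x) x| <= g / 4 * `|x| ^+ 2.
  apply: (le_trans (normr_inner_le _ _)).
  by rewrite expr2 mulrA ler_wpM2r.
have h1 j : (0 < j)%N -> lam j <= mu j + g / 4.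
  apply: (eigenvalue_perturbation be hC hT hv hu) => x.
  have := close x; rewrite innerBl ler_norml => /andP[]; lra.
have h2 j : (0 < j)%N -> mu j <= lam j + g / 4.
  apply: (eigenvalue_perturbation be hT hC hu hv) => x.
  have := close x; rewrite innerBl ler_norml => /andP[]; lra.
have glam j : (0 < j)%N -> gap lam j <= gap mu j + g / 2.
  move=> j0; rewrite /gap; case: eqP => [_|/eqP j1].
    by have := h1 1 isT; have := h2 2 isT; lra.
  have jp : (0 < j.-1)%N by case: j j0 j1 => [|[|j]].
  have a1 := h1 _ jp; have a2 := h2 _ jp; have b1 := h1 _ j0; have b2 := h2 _ j0.
  have d1 := h1 j.+1 isT; have d2 := h2 j.+1 isT.
  rewrite -lerBlDr le_min; apply/andP; split.
    by rewrite lerBlDr ge_min; apply/orP; left; lra.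
  by rewrite lerBlDr ge_min; apply/orP; right; lra.
have gmu j : (0 < j <= L)%N -> m^-1 <= gap mu j.
  case: j => [//|j] /= jL; apply: (le_trans mg).
  by have := hg j jL; have := glam j.+1 isT; lra.
apply: (Kn_ge hT hu m0) => //.
apply: (le_trans (gmu L _)); first by rewrite L0 leqnn.
exact: (gap_le hu).
Qed.

(** The interface to probability: randomness is confined to the closeness of [T] to [C] and to the
    bound [s] on the noise operator. One [eps] pays for the part of [Psi] off the leading
    eigenvectors, the other for the noise amplified by [m]. *)
Lemma estimator_close (Psi : H1 -> H2) (b : R) :
  linear Psi -> continuous Psi ->
  (forall N, \sum_(0 <= j < N) `|Psi (e j)| ^+ 2 <= b) ->
  (forall i j, (0 < i)%N -> (0 < j)%N -> i <> j -> lam i <> lam j) ->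
  forall eps, 0 < eps -> exists2 eta, 0 < eta &
  exists m0, forall (T : H1 -> H1) c' mu u m (E Delta : H1 -> H2) s,
    trace_le T c' -> eigensystem T mu u ->
    (forall x, `|T x - C x| <= eta * `|x|) -> m0 <= m ->
    linear E -> (forall x, Delta x = Psi (T x) + E x) ->
    (forall x, `|E x| <= s * `|x|) -> m * s <= eps ->
    (opnorm (fun x => Psi_hat Delta mu u (Kn mu m) x - Psi x)%R <= (2 * eps)%:E)%E.
Proof.
move=> linPsi cPsi Psib lamD eps eps0.
have [eta1 eta10 [L [L0 h1]]] := small_off_leading linPsi cPsi Psib eps0.
have [eta2 eta20 [m2 h2]] := Kn_large L0 lamD.
exists (Num.min eta1 eta2); first by rewrite lt_min eta10.
exists (Num.max 1 m2) => T c' mu u m E Delta s hT hu hTC.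
rewrite ge_max => /andP[m1 m2m] linE hD hE ms.
have m0 : 0 < m by apply: lt_le_trans m1.
have hTC1 x : `|T x - C x| <= eta1 * `|x|.
  by apply: (le_trans (hTC x)); rewrite ler_wpM2r// ge_min lexx.
have hTC2 x : `|T x - C x| <= eta2 * `|x|.
  by apply: (le_trans (hTC x)); rewrite ler_wpM2r// ge_min lexx orbT.
have LK := h2 _ _ _ _ _ hT hu hTC2 m2m.
apply: ub_ereal_sup => _ [x x1 <-]; rewrite lee_fin.
have := Psi_hat_error hu x linPsi linE hD m0 hE (@Kn_eigenvalue _ _ _ _ _ _ hu m0).
have := h1 _ _ _ _ _ hT hu hTC1 LK x x1.
have : s * m * `|x| <= eps.
  have [s0|s0] := leP 0 s.
    apply: (le_trans _ ms); rewrite [leRHS]mulrC ler_piMr//.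
    by rewrite mulr_ge0// ltW.
  apply: (@le_trans _ _ 0); last exact: ltW.
  by rewrite -mulrA nmulr_rle0// mulr_ge0// ltW.
by lra.
Qed.

End Consistency.

(** * Borel measurability in separable Hilbert spaces *)

Section BorelMeasurable.
Variable R : realType.

Lemma separable_seq (H : hilbertType R) : separable H ->
  exists a : nat -> H, forall x r, 0 < r -> exists n, `|x - a n| < r.
Proof.
move=> [D cD dD].
have [/= D0|[f]] : D = set0 \/ $|{surjfun [set: nat] >-> D}|.
  by apply/pfcard_geP; exact: cD.
  have [x []] := dD setT (ex_intro _ 0 I) (@openT H).
  by rewrite D0.
exists f => x r r0.
have [y [xy Dy]] := dD (ball x r) (ex_intro _ x (ballxx x r0)) (ball_open x r).
have [n _ fn] := @surj _ _ _ _ f y Dy.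
by exists n; rewrite fn; move: xy; rewrite -ball_normE.
Qed.

(** Separability enters here: an open set of the product is a countable union of products of balls,
    with centers in the dense sequences and radii [1 / (n + 1)]. Sums, inner products and tensors of
    random elements are all instances. *)
Lemma borel_measurable_pair d (T : measurableType d) (U V : hilbertType R)
    (W : topologicalType) (F : T -> U) (G : T -> V) (phi : U * V -> W) :
  separable U -> separable V -> continuous phi ->
  borel_measurable F -> borel_measurable G ->
  borel_measurable (fun t => phi (F t, G t)).
Proof.
move=> /separable_seq[a ha] /separable_seq[b hb] cphi mF mG B oB.
have oB' : open (phi @^-1` B) by apply: open_comp => // x _; exact: cphi.
pose r n : R := n.+1%:R^-1.
have r0 n : 0 < r n by rewrite invr_gt0 ltr0n.
pose I := [set ijn : nat * nat * nat |
  ball (a ijn.1.1) (r ijn.2) `*` ball (b ijn.1.2) (r ijn.2) `<=` phi @^-1` B].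
have -> : (fun t => phi (F t, G t)) @^-1` B =
  \bigcup_ijn (if `[< I ijn >] then F @^-1` ball (a ijn.1.1) (r ijn.2) `&`
                                G @^-1` ball (b ijn.1.2) (r ijn.2) else set0).
  apply/seteqP; split=> [t Bt|t [[[i j] n] _] /=]; last first.
    by case: asboolP => // h [Fi Gj]; exact: (h (F t, G t)).
  have : nbhs (F t, G t) (phi @^-1` B) by apply: open_nbhs_nbhs; split.
  move=> /nbhs_ballP[e /= e0 he].
  have [n /= ne] : exists n, r n < e / 2.
    have [n _ /(_ n (leqnn n))] := near_infty_natSinv_lt (PosNum (divr_gt0 e0 (ltr0n R 2))).
    by exists n.
  have [i hi] := ha (F t) (r n) (r0 n).
  have [j hj] := hb (G t) (r n) (r0 n).
  exists (i, j, n) => //; case: asboolP => [_|[]] /=.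
    by split; rewrite /= -ball_normE/= distrC.
  move=> [x y] /= []; rewrite -!ball_normE/= => hx hy; apply: he; split => /=.
    rewrite -ball_normE/=; have := ler_distD (a i) (F t) x; lra.
  rewrite -ball_normE/=; have := ler_distD (b j) (G t) y; lra.
apply: countable_bigcupT_measurable; first exact: countableP.
move=> [[i j] n]; case: asboolP => _ //.
by apply: measurableI; [apply: mF|apply: mG]; exact: ball_open.
Qed.

Lemma borel_measurable_comp d (T : measurableType d) (U W : topologicalType)
    (F : T -> U) (phi : U -> W) : continuous phi ->
  borel_measurable F -> borel_measurable (phi \o F).
Proof.
move=> cphi mF B oB; rewrite comp_preimage; apply: mF.
by apply: open_comp => // x _; exact: cphi.
Qed.

Lemma borel_measurable_real d (T : measurableType d) (f : T -> R) :
  borel_measurable f -> measurable_fun setT f.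
Proof.
move=> mf; apply: (measurability _ (measurable_realfun.RGenOpens.measurableE R)).
move=> _ [_ [x [y ->]] <-].
by rewrite setTI; apply: mf; exact: interval_open.
Qed.

Lemma borel_measurable_comp_fun d d' (T : measurableType d)
    (T' : measurableType d') (U : topologicalType) (F : T' -> U) (p : T -> T') :
  measurable_fun setT p -> borel_measurable F -> borel_measurable (F \o p).
Proof.
move=> mp mF B oB; rewrite comp_preimage -[X in measurable X]setTI.
by apply: (mp measurableT); exact: mF.
Qed.

Section Hilbert.
Context d (T : measurableType d) (H : hilbertType R).
Hypothesis sepH : separable H.
Implicit Types F G : T -> H.

Lemma borel_measurable_cst (x : H) : borel_measurable (fun _ : T => x).
Proof.
by move=> B _; rewrite preimage_cst; case: ifP.
Qed.

Lemma borel_measurableD F G : borel_measurable F -> borel_measurable G ->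
  borel_measurable (fun t => F t + G t).
Proof.
by apply: (borel_measurable_pair (phi := fun z => z.1 + z.2)) => //; exact: add_continuous.
Qed.

Lemma borel_measurableB F G : borel_measurable F -> borel_measurable G ->
  borel_measurable (fun t => F t - G t).
Proof.
apply: (borel_measurable_pair (phi := fun z => z.1 - z.2)) => //.
exact: sub_continuous.
Qed.

Lemma borel_measurableZ (a : R) F : borel_measurable F ->
  borel_measurable (fun t => a *: F t).
Proof. by apply: borel_measurable_comp => x; exact: scaler_continuous. Qed.

Lemma borel_measurable_sum (s : seq nat) (F : nat -> T -> H) :
  (forall i, i \in s -> borel_measurable (F i)) ->
  borel_measurable (fun t => \sum_(i <- s) F i t).
Proof.
elim: s => [|i s IH] h.
  under eq_fun do rewrite big_nil; exact: borel_measurable_cst.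
under eq_fun do rewrite big_cons.
apply: borel_measurableD; first by apply: h; rewrite mem_head.
by apply: IH => j js; apply: h; rewrite in_cons js orbT.
Qed.

Lemma measurable_norm F : borel_measurable F ->
  measurable_fun setT (fun t => `|F t|).
Proof.
move=> mF; apply: borel_measurable_real.
by apply: (borel_measurable_comp _ mF) => x; exact: norm_continuous.
Qed.

Lemma measurable_inner F G : borel_measurable F -> borel_measurable G ->
  measurable_fun setT (fun t => inner (F t) (G t)).
Proof.
move=> mF mG; apply: borel_measurable_real.
by apply: (borel_measurable_pair (phi := fun z => inner z.1 z.2)) => //; exact: continuous_inner.
Qed.

End Hilbert.

Lemma borel_measurable_tens d (T : measurableType d) (H H' : hilbertType R)
    (F : T -> H) (G : T -> H') (x : H) : separable H -> separable H' ->
  borel_measurable F -> borel_measurable G ->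
  borel_measurable (fun t => tens (F t) (G t) x).
Proof.
move=> sH sH'.
apply: (borel_measurable_pair (phi := fun z => tens z.1 z.2 x)) => // z.
apply: cvgZ; last exact: cvg_snd.
apply: (@cvg_inner _ _ _ _ _ (fun z : H * H' => z.1) (fun=> x)).
  exact: cvg_fst.
exact: cvg_cst.
Qed.

End BorelMeasurable.

(** * Laws of paths of i.i.d. variables, and independence *)

Section IntegralLaw.
Context d (T : measurableType d) (R : realType) (P : probability T R).
Local Open Scope ereal_scope.

Lemma integral_distribution d' (T' : measurableType d') (X : {mfun T >-> T'})
    (f : T' -> \bar R) : measurable_fun setT f ->
  \int[distribution P X]_x f x = \int[P]_w f (X w).
Proof.
move=> mf; rewrite integralE [RHS]integralE.
congr (_ - _); rewrite ge0_integral_pushforward ?preimage_setT//.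
- by apply: eq_integral => w _; rewrite /= !funeposE.
- exact: measurable_funepos.
- by apply: eq_integral => w _; rewrite /= !funenegE.
- exact: measurable_funeneg.
Qed.

End IntegralLaw.

Section Paths.
Context {dS : measure_display} {S : measurableType dS}.

Definition finite_cylinder (J : choiceType) (s : seq J) (A : J -> set S) :
  set (J -> S) := \bigcap_(j in [set` s]) [set x | A j (x j)].

Definition finite_cylinders (J : choiceType) : set (set (J -> S)) :=
  [set B | exists s (A : J -> set S),
    (forall j, measurable (A j)) /\ B = finite_cylinder s A].

(* Generated by the finite cylinders rather than by the sets [cylinders]: being
   stable under intersection, they determine the law of a path, and their
   products determine the joint law of two paths. *)
Definition pathType (J : choiceType) := g_sigma_algebraType (@finite_cylinders J).

HB.instance Definition _ (J : choiceType) := Measurable.on (pathType J).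

Lemma finite_cylindersT (J : choiceType) : finite_cylinders (setT : set (J -> S)).
Proof.
exists [::], (fun=> setT); split => //.
by apply/seteqP; split => // x _ j; rewrite /= in_nil.
Qed.

Lemma finite_cylinders_setI (J : choiceType) : setI_closed (@finite_cylinders J).
Proof.
move=> _ _ [s [A [mA ->]]] [t [B [mB ->]]].
exists (s ++ t), (fun j => (if j \in s then A j else setT) `&`
                           (if j \in t then B j else setT)); split.
  by move=> j; apply: measurableI; case: ifP.
apply/seteqP; split => [x [xA xB] j _ /=|x h].
  by split; case: ifP => // js; [exact: xA|exact: xB].
split=> j /= js; have := h j; rewrite /= mem_cat js ?orbT => /(_ isT).
  by case.
by case.
Qed.

Lemma measurable_coord (J : choiceType) (j : J) (A : set S) : measurable A ->
  measurable ([set x | A (x j)] : set (pathType J)).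
Proof.
move=> mA; apply: sub_sigma_algebra; exists [:: j], (fun=> A); split => //.
apply/seteqP; split => [x Ax i /=|x].
  by rewrite inE => /eqP ->.
by move=> /(_ j); apply; rewrite /= mem_head.
Qed.

Lemma cylinders_measurable (B : set (nat -> S)) : <<s cylinders >> B ->
  measurable (B : set (pathType nat)).
Proof.
move: B; apply: smallest_sub; first exact: (sigma_algebra_measurable (pathType nat)).
by move=> _ [i [A [mA ->]]]; exact: measurable_coord.
Qed.

Lemma measurable_reindex (J J' : choiceType) (r : J' -> J) :
  measurable_fun setT (fun x : pathType J => (x \o r : pathType J')).
Proof.
apply: (@measurability _ _ (pathType J) (pathType J') setT _ (@finite_cylinders J')) => //.
move=> _ [_ [s [A [mA ->]]] <-]; rewrite setTI.
rewrite /finite_cylinder preimage_bigcap; apply: fin_bigcap_measurable => // j _.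
exact: (measurable_coord (r j) (mA j)).
Qed.

Definition cylinder_rectangles (J J' : choiceType) : set (set ((J -> S) * (J' -> S))) :=
  [set B `*` B' | B in @finite_cylinders J & B' in @finite_cylinders J'].

(** The whole space is a finite cylinder, so rectangles with one full side already make both
    projections measurable. *)
Lemma prod_pathTypeE (J J' : choiceType) :
  (measurable : set (set (pathType J * pathType J'))) =
  <<s @cylinder_rectangles J J' >>.
Proof.
pose T := g_sigma_algebraType (@cylinder_rectangles J J').
have m1 : measurable_fun setT (fst : T -> pathType J).
  apply: (@measurability _ _ T (pathType J) setT _ (@finite_cylinders J)) => //.
  move=> _ [B hB <-]; apply: sub_sigma_algebra.
  exists B => //; exists setT; first exact: finite_cylindersT.
  by apply/seteqP; split => -[x y] []//.
have m2 : measurable_fun setT (snd : T -> pathType J').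
  apply: (@measurability _ _ T (pathType J') setT _ (@finite_cylinders J')) => //.
  move=> _ [B hB <-]; apply: sub_sigma_algebra.
  exists setT; first exact: finite_cylindersT.
  by exists B => //; apply/seteqP; split => -[x y] []//.
rewrite measurable_prod_measurableType; apply/seteqP; split; apply: smallest_sub.
- exact: smallest_sigma_algebra.
- move=> _ [A mA [B mB <-]].
  suff -> : A `*` B = (setT `&` fst @^-1` A) `&` (setT `&` snd @^-1` B) :> set T.
    by apply: (@measurableI _ T); [exact: m1|exact: m2].
  by apply/seteqP; split => -[x y] /= [] // [_ ?] [_ ?].
- exact: smallest_sigma_algebra.
- move=> _ [B hB [B' hB' <-]]; apply: sub_sigma_algebra.
  by exists B; [exact: sub_sigma_algebra|exists B' => //; exact: sub_sigma_algebra].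
Qed.

Context {d : measure_display} {Omega : measurableType d} {I : choiceType}.
Context {R : realType} (P : probability Omega R).
Variables (Z : I -> Omega -> S) (i0 : I).
Hypothesis iidZ : iid P Z.

(** Causal, coupled and time-shifted paths are all reindexings of one i.i.d. family, so that their
    laws can be compared by a single argument. *)
Definition sample (J : choiceType) (sigma : J -> I) (w : Omega) : pathType J :=
  fun j => Z (sigma j) w.

Lemma measurable_path (J : choiceType) (sigma : J -> I) :
  measurable_fun setT (sample sigma).
Proof.
apply: (@measurability _ _ Omega (pathType J) setT _ (@finite_cylinders J)) => //.
move=> _ [_ [s [A [mA ->]]] <-]; rewrite setTI.
rewrite /finite_cylinder preimage_bigcap; apply: fin_bigcap_measurable => // j _.
have [mZ _ _] := iidZ.
rewrite -[X in measurable X]setTI; exact: (mZ (sigma j) measurableT (A j) (mA j)).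
Qed.

(** The right side does not depend on [sigma], which is why all injective reindexings have the same
    law. [i0] names the common marginal; independence speaks of duplicate-free lists, hence
    [undup]. *)
Lemma iid_finite_cylinder (J : choiceType) (sigma : J -> I) (s : seq J)
    (A : J -> set S) : injective sigma -> (forall j, measurable (A j)) ->
  P (sample sigma @^-1` finite_cylinder s A) =
  (\prod_(j <- undup s) P (Z i0 @^-1` A j))%E.
Proof.
move=> inj mA; have [_ ind idt] := iidZ.
(* The constraints are carried from [J] to [I] along [sigma]; off the range of [sigma] this is the
   whole space. *)
pose A' i := [set x | forall j, sigma j = i -> A j x].
have A'E j : A' (sigma j) = A j.
  by apply/seteqP; split => [x /(_ j erefl)//|x Ax k /inj ->].
have mA' i : measurable (A' i).
  have [[j <-]|h] := pselect (exists j, sigma j = i); first by rewrite A'E.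
  suff -> : A' i = setT by [].
  by apply/seteqP; split => // x _ j ji; case: h; exists j.
have -> : sample sigma @^-1` finite_cylinder s A =
    \bigcap_(i in [set` map sigma (undup s)]) (Z i @^-1` A' i).
  apply/seteqP; split => [w h _ /= /mapP[j js ->]|w h j /= js].
    by rewrite A'E; apply: h; rewrite /= -mem_undup.
  have := h (sigma j); rewrite /= A'E; apply.
  by apply: map_f; rewrite mem_undup.
rewrite ind//; last by rewrite map_inj_uniq ?undup_uniq.
by rewrite big_map; apply: eq_bigr => j _; rewrite A'E; exact: idt.
Qed.

Let pathM (J : choiceType) (sigma : J -> I) : {mfun Omega >-> pathType J} :=
  HB.pack (sample sigma) (isMeasurableFun.Build _ _ _ _ _ (measurable_path sigma)).

Lemma iid_law (J : choiceType) (sigma tau : J -> I) (f : pathType J -> \bar R) :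
  injective sigma -> injective tau -> measurable_fun setT f ->
  (\int[P]_w f (sample sigma w) = \int[P]_w f (sample tau w))%E.
Proof.
move=> isig itau mf.
rewrite -(integral_distribution P (pathM sigma) mf).
rewrite -(integral_distribution P (pathM tau) mf).
apply: eq_measure_integral => A mA _.
apply: (@measure_unique _ _ (pathType J) (@finite_cylinders J) (fun=> setT)) => //.
- exact: finite_cylinders_setI.
- by move=> _; exact: finite_cylindersT.
- by rewrite bigcup_const.
- move=> _ [s [B [mB ->]]].
  exact: (eq_trans (iid_finite_cylinder s isig mB)
                   (esym (iid_finite_cylinder s itau mB))).
- by move=> _; rewrite (@le_lt_trans _ _ 1%E) ?ltry// probability_le1.
Qed.

Let pairM (J J' : choiceType) (sigma : J -> I) (tau : J' -> I) :
    {mfun Omega >-> (pathType J * pathType J')%type} :=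
  HB.pack (fun w => (sample sigma w, sample tau w))
    (isMeasurableFun.Build _ _ _ _ _
      (measurable_fun_pair (measurable_path sigma) (measurable_path tau))).

Lemma iid_indep_law (J J' : choiceType) (sigma : J -> I) (tau : J' -> I) :
  injective sigma -> injective tau -> (forall j j', sigma j <> tau j') ->
  forall A, measurable A ->
  (distribution P (pathM sigma) \x distribution P (pathM tau))%E A =
  distribution P (pairM sigma tau) A.
Proof.
move=> isig itau dis A mA.
pose G := @cylinder_rectangles J J'.
have fcm (K : choiceType) (B : set (K -> S)) : finite_cylinders B ->
  measurable (B : set (pathType K)) by exact: sub_sigma_algebra.
apply: (@measure_unique _ _ (pathType J * pathType J')%type G (fun=> setT)) => //.
- exact: prod_pathTypeE.
- move=> _ _ [B hB [B' hB' <-]] [D hD [D' hD' <-]].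
  rewrite -setXI; exists (B `&` D); first exact: finite_cylinders_setI.
  by exists (B' `&` D') => //; exact: finite_cylinders_setI.
- move=> _; exists setT; first exact: finite_cylindersT.
  by exists setT; [exact: finite_cylindersT|rewrite setXTT].
- by rewrite bigcup_const.
- move=> _ [B hB [B' hB' <-]].
  rewrite /= product_measure1E; [|exact: fcm|exact: fcm].
  case: hB => s [D [mD ->]]; case: hB' => t [E [mE ->]].
  transitivity (P (sample sigma @^-1` finite_cylinder s D) *
    P (sample tau @^-1` finite_cylinder t E))%E; first by [].
  rewrite !iid_finite_cylinder//.
  (* Disjoint ranges glue [sigma] and [tau] into one injective reindexing, and the product formula
     for its cylinders factors as required. *)
  pose rho (k : J + J') := match k with inl j => sigma j | inr j => tau j end.
  pose F (k : J + J') := match k with inl j => D j | inr j => E j end.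
  have irho : injective rho.
    move=> [j|j] [k|k] /=; [by move/isig ->| | |by move/itau ->].
      by move/dis.
    by move=> /esym/dis.
  have mF k : measurable (F k) by case: k => j /=.
  pose st := map inl (undup s) ++ map inr (undup t) : seq (J + J').
  have ust : uniq st.
    rewrite cat_uniq !map_inj_uniq ?undup_uniq//=; [|by move=> ? ? []..].
    rewrite andbT; apply/hasPn => _ /mapP[j _ ->].
    by apply/mapP => -[].
  transitivity (P (sample rho @^-1` finite_cylinder st F)).
    by rewrite iid_finite_cylinder// (undup_id ust) big_cat/= !big_map.
  congr (P _); apply/seteqP; split => [w h|w [h1 h2] [j|j] /=].
  + split => j /= js.
      by have := h (inl j); rewrite /= mem_cat (map_f inl) ?mem_undup// => /(_ isT).
    by have := h (inr j); rewrite /= mem_cat (map_f inr) ?mem_undup// orbT => /(_ isT).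
  + by rewrite mem_cat (mem_map (@inl_inj _ _)) => /orP[|/mapP[]//]; rewrite mem_undup => /h1.
  + by rewrite mem_cat (mem_map (@inr_inj _ _)) => /orP[/mapP[]//|]; rewrite mem_undup => /h2.
- by move=> _; rewrite (@le_lt_trans _ _ 1%E) ?ltry// probability_le1.
Qed.

(** Fubini on the product of the two laws, integrability being transported from the joint law. *)
Lemma iid_indep_integral (J J' : choiceType) (sigma : J -> I) (tau : J' -> I)
    (h : pathType J * pathType J' -> \bar R) :
  injective sigma -> injective tau -> (forall j j', sigma j <> tau j') ->
  measurable_fun setT h ->
  P.-integrable setT (fun w => h (sample sigma w, sample tau w)) ->
  (\int[P]_w h (sample sigma w, sample tau w) =
   \int[P]_w \int[P]_w' h (sample sigma w, sample tau w'))%E.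
Proof.
move=> isig itau dis mh ih.
have law := iid_indep_law isig itau dis.
have eqm (f : pathType J * pathType J' -> \bar R) : measurable_fun setT f ->
  (\int[distribution P (pathM sigma) \x distribution P (pathM tau)]_x f x =
  \int[P]_w f (sample sigma w, sample tau w))%E.
  move=> mf; rewrite -(integral_distribution P (pairM sigma tau) mf).
  by apply: eq_measure_integral => A mA _; exact: law.
have ih' : (distribution P (pathM sigma) \x distribution P (pathM tau))%E.-integrable setT h.
  apply/integrableP; split => //; rewrite eqm; last exact: measurableT_comp.
  by case/integrableP : ih.
rewrite -eqm// -integral12_prod_meas1// /fubini_F.
rewrite (integral_distribution P (pathM sigma));
  last exact: measurable_int (integrable_fubini_F ih').
apply: eq_integral => w _.
rewrite (integral_distribution P (pathM tau))//.
apply: (measurableT_comp mh).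
exact: pair1_measurable.
Qed.

End Paths.

(** * Expectations and moments *)

Section Expectation.
Context d (T : measurableType d) (R : realType) (P : probability T R).

Implicit Types f g : T -> R.

(** A real-valued integral sends infinite values to 0, hence the [L1] hypotheses in the rules
    below. *)
Definition mean (f : T -> R) : R := (\int[P]_w f w)%R.

Definition L1 (f : T -> R) : Prop := P.-integrable setT (EFin \o f).

Lemma L1_le f g : measurable_fun setT f -> (forall w, `|f w| <= g w) ->
  L1 g -> L1 f.
Proof.
move=> mf fg; apply: le_integrable => //; first exact/measurable_EFinP.
by move=> w _; rewrite lee_fin (le_trans (fg w))// ler_norm.
Qed.

Lemma L1_cst c : L1 (fun=> c).
Proof. exact: finite_measure_integrable_cst. Qed.

Lemma L1D f g : L1 f -> L1 g -> L1 (fun w => f w + g w).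
Proof. by move=> hf hg; apply: eq_integrable (integrableD _ hf hg). Qed.

Lemma L1B f g : L1 f -> L1 g -> L1 (fun w => f w - g w).
Proof. by move=> hf hg; apply: eq_integrable (integrableB _ hf hg). Qed.

Lemma L1Z c f : L1 f -> L1 (fun w => c * f w).
Proof. by move=> hf; apply: eq_integrable (integrableZl _ _ hf). Qed.

Lemma L1_sum (I : Type) (s : seq I) (f : I -> T -> R) :
  (forall i, L1 (f i)) -> L1 (fun w => \sum_(i <- s) f i w).
Proof.
move=> hf; elim: s => [|i s IH].
  by under eq_fun do rewrite big_nil; exact: L1_cst.
by under eq_fun do rewrite big_cons; exact: L1D.
Qed.

Lemma mean_cst c : mean (fun=> c) = c.
Proof.
rewrite /mean Rintegral_cst// [X in fine X](_ : _ = 1%E) ?mulr1//.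
exact: probability_setT.
Qed.

Lemma meanD f g : L1 f -> L1 g -> mean (fun w => f w + g w) = mean f + mean g.
Proof. by move=> hf hg; exact: RintegralD. Qed.

Lemma meanB f g : L1 f -> L1 g -> mean (fun w => f w - g w) = mean f - mean g.
Proof. by move=> hf hg; exact: RintegralB. Qed.

Lemma meanZ c f : L1 f -> mean (fun w => c * f w) = c * mean f.
Proof. by move=> hf; exact: RintegralZl. Qed.

Lemma mean_sum (I : Type) (s : seq I) (f : I -> T -> R) :
  (forall i, L1 (f i)) ->
  mean (fun w => \sum_(i <- s) f i w) = \sum_(i <- s) mean (f i).
Proof.
move=> hf; elim: s => [|i s IH].
  by rewrite big_nil; under eq_fun do rewrite big_nil; exact: mean_cst.
rewrite big_cons -IH -meanD//; last exact: L1_sum.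
by congr mean; apply/funext => w; rewrite big_cons.
Qed.

Lemma mean_le f g : L1 f -> L1 g -> (forall w, f w <= g w) -> mean f <= mean g.
Proof. by move=> hf hg fg; apply: le_Rintegral. Qed.

Lemma mean_ge0 f : (forall w, 0 <= f w) -> 0 <= mean f.
Proof. by move=> f0; apply: Rintegral_ge0. Qed.

Lemma EFin_mean f : L1 f -> (mean f)%:E = (\int[P]_w (f w)%:E)%E.
Proof. by move=> hf; rewrite fineK//; exact: integrable_fin_num. Qed.

Lemma nu4_moment (H : hilbertType R) (X : T -> H) :
  measurable_fun setT (fun w => `|X w|) -> (nu P 4 X < +oo)%E ->
  L1 (fun w => `|X w| ^+ 4) /\
  mean (fun w => `|X w| ^+ 4) = fine (nu P 4 X) ^+ 4.
Proof.
move=> mX; rewrite /nu unlock /=.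
under eq_integral => w _ do rewrite normr_id powR_mulrn//.
have m4 : measurable_fun setT (fun w => `|X w| ^+ 4) by exact: measurable_funX.
have pos : (0 <= \int[P]_w (`|X w| ^+ 4)%:E)%E.
  by apply: integral_ge0 => w _; rewrite lee_fin exprn_ge0.
move=> fin4.
have fin : (\int[P]_w (`|X w| ^+ 4)%:E < +oo)%E.
  rewrite ltey; apply: contraTneq fin4 => ->.
  by rewrite poweRyr ?ltxx.
have hL : L1 (fun w => `|X w| ^+ 4).
  apply/integrableP; split; first exact/measurable_EFinP.
  rewrite (eq_integral (fun w => (`|X w| ^+ 4)%:E))// => w _ /=.
  by rewrite ger0_norm// exprn_ge0.
split => //.
have m0 : 0 <= mean (fun w => `|X w| ^+ 4) by apply: mean_ge0 => w; rewrite exprn_ge0.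
rewrite -EFin_mean// poweR_EFin /=.
by rewrite -powR_mulrn ?powR_ge0// -powRrM mulVf// powRr1.
Qed.

Lemma Markov (f : T -> \bar R) (t : R) : measurable_fun setT f ->
  (forall w, 0 <= f w)%E -> 0 < t ->
  (P [set w | t%:E <= f w] <= (t^-1)%:E * \int[P]_w f w)%E.
Proof.
move=> mf f0 t0.
rewrite -(@lee_pmul2l _ t%:E)// muleA -EFinM divff ?gt_eqF// mul1e.
have := @le_integral_comp_abse _ _ _ P _ measurableT f t id (@measurable_id _ _ _)
  (fun r r0 => r0) (fun x y _ _ xy => xy) mf t0.
rewrite setTI (eq_integral f) => [|w _]; last by rewrite gee0_abs.
by congr (_ * P _ <= _)%E; apply/seteqP; split => w /=; rewrite gee0_abs.
Qed.

End Expectation.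

(** * Hilbert-Schmidt bounds for tensors *)

Section HilbertSchmidtBounds.
Variables (R : realType) (H H' : hilbertType R) (e : nat -> H).
Hypothesis oe : orthonormal_seq e.

Lemma sum_sqr_norm_tens_le (x : H) (y : H') J :
  \sum_(j < J) `|tens x y (e j)| ^+ 2 <= `|x| ^+ 2 * `|y| ^+ 2.
Proof.
under eq_bigr do rewrite /tens normrZ exprMn real_normK ?num_real// innerC.
rewrite -mulr_suml ler_wpM2r ?sqr_ge0//.
exact: (Bessel x (orthonormal_upto_seq oe (J:=J))).
Qed.

Lemma inner_le_weighted (a b : H') (r : R) : 0 < r ->
  inner a b <= r / 2 * `|a| ^+ 2 + (2 * r)^-1 * `|b| ^+ 2.
Proof.
move=> r0; have : 0 <= `|r *: a - b| ^+ 2 by rewrite sqr_ge0.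
rewrite sqr_normB innerZl normrZ exprMn real_normK ?num_real// => h.
rewrite -(@ler_pM2l _ (2 * r)) ?mulr_gt0//.
have -> : 2 * r * (r / 2 * `|a| ^+ 2 + (2 * r)^-1 * `|b| ^+ 2) =
  r ^+ 2 * `|a| ^+ 2 + `|b| ^+ 2 by field; rewrite gt_eqF.
by lra.
Qed.

(* The powers of [r] balance the terms once the differences [xl - x'] and
   [yl - y'] are of size [r]. *)
Lemma sum_inner_tens_le (x xl x' : H) (y yl y' : H') (r : R) J : 0 < r ->
  \sum_(j < J) inner (tens x y (e j)) (tens xl yl (e j) - tens x' y' (e j)) <=
  r / 4 * (`|x| ^+ 4 + `|y| ^+ 4) +
  (2 * r)^-1 * (r ^- 2 * `|xl - x'| ^+ 4 + r ^+ 2 * `|yl| ^+ 4 +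
                (r ^+ 2 * `|x'| ^+ 4 + r ^- 2 * `|yl - y'| ^+ 4)).
Proof.
move=> r0.
have amgm (s a b : R) : 0 < s -> a * b <= 2^-1 * (s^-1 * a ^+ 2 + s * b ^+ 2).
  move=> s0; rewrite -(@ler_pM2l _ (2 * s)) ?mulr_gt0//.
  have -> : 2 * s * (2^-1 * (s^-1 * a ^+ 2 + s * b ^+ 2)) =
    a ^+ 2 + s ^+ 2 * b ^+ 2 by field; rewrite gt_eqF.
  by have := sqr_ge0 (a - s * b); nra.
have r20 : 0 < r ^+ 2 by rewrite exprn_gt0.
apply: (@le_trans _ _ (\sum_(j < J) (r / 2 * `|tens x y (e j)| ^+ 2 +
   r^-1 * (`|tens (xl - x') yl (e j)| ^+ 2 + `|tens x' (yl - y') (e j)| ^+ 2)))).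
  apply: ler_sum => j _.
  apply: (le_trans (inner_le_weighted _ _ r0)); rewrite lerD2l.
  have -> : tens xl yl (e j) - tens x' y' (e j) =
      tens (xl - x') yl (e j) + tens x' (yl - y') (e j).
    by rewrite /tens innerBl scalerBl scalerBr addrA subrK.
  set A := `|tens (xl - x') yl (e j)| ^+ 2.
  set B' := `|tens x' (yl - y') (e j)| ^+ 2.
  have -> : r^-1 * (A + B') = (2 * r)^-1 * (2 * (A + B')) by field; rewrite gt_eqF.
  rewrite ler_wpM2l ?invr_ge0 ?mulr_ge0 ?(ltW r0)//; exact: sqr_normD_le.
rewrite big_split /= -!mulr_sumr big_split /=.
have t1 := sum_sqr_norm_tens_le x y J.
have t2 := sum_sqr_norm_tens_le (xl - x') yl J.
have t3 := sum_sqr_norm_tens_le x' (yl - y') J.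
have a1 := amgm 1 (`|x| ^+ 2) (`|y| ^+ 2) ltr01.
have a2 := amgm (r ^+ 2) (`|xl - x'| ^+ 2) (`|yl| ^+ 2) r20.
have a3 := amgm (r ^+ 2) (`|yl - y'| ^+ 2) (`|x'| ^+ 2) r20.
rewrite -!exprM !muln2 /= in a1 a2 a3.
rewrite invr1 !mul1r in a1.
apply: lerD.
  apply: (@le_trans _ _ (r / 2 * (2^-1 * (`|x| ^+ 4 + `|y| ^+ 4)))).
    by rewrite ler_wpM2l ?divr_ge0 ?(ltW r0)// (le_trans t1).
  by rewrite le_eqVlt; apply/orP; left; apply/eqP; field.
rewrite invfM -mulrA mulrCA; apply: ler_wpM2l; first by rewrite invr_ge0 ltW.
by rewrite [leLHS]mulrC in a3; lra.
Qed.

End HilbertSchmidtBounds.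

(** * Covariances of tensors of coupled sequences *)

Section SecondMoments.
Context {d dS : measure_display} {Omega : measurableType d} {S : measurableType dS}.
Context {R : realType} (P : probability Omega R).
Variables (delta delta' : int -> Omega -> S).
Hypothesis innov : innovations P delta delta'.
Variables (H H' : hilbertType R).
Hypotheses (sepH : separable H) (sepH' : separable H').
Variables (F : pathType (S:=S) nat -> H) (G : pathType (S:=S) nat -> H').
Hypotheses (mF : borel_measurable F) (mG : borel_measurable G).

Local Notation Z := (fun bi : bool * int => if bi.1 then delta' bi.2 else delta bi.2).
Local Notation pth := (sample Z).
Local Notation E := (mean P).
Local Notation L1 := (L1 P).
Local Notation idx := (nat -> bool * int).

Definition causal_index (n : nat) : idx := fun i => (false, n%:Z - i%:Z).

Definition coupled_index (m n : nat) : idx :=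
  fun i => (~~ (i < m)%N, n%:Z - i%:Z).

Lemma causal_index_inj n : injective (causal_index n).
Proof. by move=> i j [] /eqP; rewrite (inj_eq (addrI _)) eqr_opp => /eqP[]. Qed.

Lemma coupled_index_inj m n : injective (coupled_index m n).
Proof. by move=> i j [_] /eqP; rewrite (inj_eq (addrI _)) eqr_opp => /eqP[]. Qed.

(** The coordinates of [delta] kept in the coupled path at time [k + m] have times [k + 1] to
    [k + m], all later than the path at time [k]; the other coordinates come from [delta']. *)
Lemma causal_coupled_disjoint k m i j :
  causal_index k i <> coupled_index m (k + m) j.
Proof.
by move=> [] /esym/negbFE jm h; lia.
Qed.

Lemma mean_law (J : choiceType) (phi : pathType (S:=S) J -> R) (sigma tau : J -> bool * int) :
  injective sigma -> injective tau -> measurable_fun setT phi ->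
  E (fun w => phi (pth sigma w)) = E (fun w => phi (pth tau w)).
Proof.
move=> isig itau mphi; congr fine.
apply: (iid_law (false, 0) innov isig itau (f := EFin \o phi)).
exact/measurable_EFinP.
Qed.

Lemma L1_law (J : choiceType) (phi : pathType (S:=S) J -> R) (sigma tau : J -> bool * int) :
  injective sigma -> injective tau -> measurable_fun setT phi ->
  L1 (fun w => phi (pth sigma w)) -> L1 (fun w => phi (pth tau w)).
Proof.
move=> isig itau mphi /integrableP[_ fi]; apply/integrableP; split.
  apply/measurable_EFinP; apply: (measurableT_comp mphi).
  exact: (measurable_path innov).
rewrite (le_lt_trans _ fi)// le_eqVlt; apply/orP; left; apply/eqP.
apply: (iid_law (false, 0) innov itau isig (f := fun x => `|(phi x)%:E|%E)).
by apply: measurableT_comp => //; exact/measurable_EFinP.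
Qed.

Lemma path_measurable (K : hilbertType R) (U : pathType (S:=S) nat -> K) (sigma : idx) :
  borel_measurable U -> borel_measurable (fun w => U (pth sigma w)).
Proof.
move=> mU; apply: (borel_measurable_comp_fun (p := pth sigma)) => //.
exact: (measurable_path innov).
Qed.

Section Coupling.
Variables (K : hilbertType R) (U : pathType (S:=S) nat -> K).
Hypotheses (sepK : separable K) (mU : borel_measurable U).
Hypothesis U4 : L1 (fun w => `|U (pth (causal_index 1) w)| ^+ 4).

Let mU4 : measurable_fun setT (fun x => `|U x| ^+ 4).
Proof. by apply: measurable_funX; exact: measurable_norm. Qed.

Lemma L1_moment4 sigma : injective sigma -> L1 (fun w => `|U (pth sigma w)| ^+ 4).
Proof. by move=> isig; apply: (L1_law (@causal_index_inj 1) isig mU4 U4). Qed.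

Lemma moment4_law sigma : injective sigma ->
  E (fun w => `|U (pth sigma w)| ^+ 4) =
  E (fun w => `|U (pth (causal_index 1) w)| ^+ 4).
Proof. by move=> isig; apply: (mean_law isig (@causal_index_inj 1) mU4). Qed.

Lemma L1_moment2 sigma : injective sigma -> L1 (fun w => `|U (pth sigma w)| ^+ 2).
Proof.
move=> isig; apply: (@L1_le _ _ _ _ _ (fun w => 1 + `|U (pth sigma w)| ^+ 4)).
- by apply: measurable_funX; apply: measurable_norm; exact: path_measurable.
- move=> w; rewrite ger0_norm ?sqr_ge0//.
  rewrite -[4%N]/(2 * 2)%N exprM.
  by have := sqr_ge0 (`|U (pth sigma w)| ^+ 2 - 1); have := sqr_ge0 (`|U (pth sigma w)|); nra.
- by apply: L1D; [exact: L1_cst|exact: L1_moment4].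
Qed.

Lemma L1_coupling4 sigma tau : injective sigma -> injective tau ->
  L1 (fun w => `|U (pth sigma w) - U (pth tau w)| ^+ 4).
Proof.
move=> isig itau.
apply: (@L1_le _ _ _ _ _ (fun w =>
   8 * (`|U (pth sigma w)| ^+ 4 + `|U (pth tau w)| ^+ 4))).
- apply: measurable_funX; apply: measurable_norm.
  by apply: borel_measurableB => //; exact: path_measurable.
- move=> w; rewrite ger0_norm ?exprn_ge0//.
  set a := U _; set b := U _.
  have h := sqr_normD_le a (- b); rewrite normrN in h.
  rewrite -[4%N]/(2 * 2)%N !exprM.
  apply: (@le_trans _ _ ((2 * (`|a| ^+ 2 + `|b| ^+ 2)) ^+ 2)).
    by rewrite ler_pXn2r// nnegrE ?sqr_ge0// mulr_ge0// addr_ge0// sqr_ge0.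
  by have := sqr_ge0 (`|a| ^+ 2 - `|b| ^+ 2); nra.
- by apply: L1Z; apply: L1D; exact: L1_moment4.
Qed.

(** Stationarity: shifting all innovations by [k] preserves their joint law. Approximability
    controls the coupling at lag [m] only at time [m], and this carries it to every later time. *)
Lemma coupling4_shift k m :
  E (fun w => `|U (pth (causal_index (k + m)) w) -
                U (pth (coupled_index m (k + m)) w)| ^+ 4) =
  E (fun w => `|U (pth (causal_index m) w) - U (pth (coupled_index m m) w)| ^+ 4).
Proof.
pose shift (bi : bool * int) := (bi.1, bi.2 + k%:Z).
have ish : injective shift by move=> [b i] [b' i'] [-> /addIr ->].
(* Both paths are read off one path over all innovations, so that equality in law applies to them
   jointly. *)
pose phi (x : pathType (S:=S) (bool * int)%type) :=
  `|U ((x \o causal_index m) : pathType nat) -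
    U ((x \o coupled_index m m) : pathType nat)| ^+ 4.
have mphi : measurable_fun setT phi.
  apply: measurable_funX; apply: measurable_norm.
  apply: borel_measurableB => //.
    exact: (borel_measurable_comp_fun (measurable_reindex (causal_index m)) mU).
  exact: (borel_measurable_comp_fun (measurable_reindex (coupled_index m m)) mU).
have := mean_law ish (@inj_id _) mphi.
have e1 w : (pth shift w \o causal_index m) = pth (causal_index (k + m)) w.
  apply/funext => i; rewrite /sample /shift /causal_index /=.
  by congr (delta _ w); lia.
have e2 w : (pth shift w \o coupled_index m m) = pth (coupled_index m (k + m)) w.
  apply/funext => i; rewrite /sample /shift /coupled_index /=.
  have -> : m%:Z - i%:Z + k%:Z = (k + m)%N%:Z - i%:Z by lia.
  by [].
rewrite /phi => h.
rewrite -[RHS]h; congr mean; apply/funext => w.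
by rewrite e1 e2.
Qed.

End Coupling.

Lemma L1_inner (K : hilbertType R) (A B : Omega -> K) : separable K ->
  borel_measurable A -> borel_measurable B ->
  L1 (fun w => `|A w| ^+ 2) -> L1 (fun w => `|B w| ^+ 2) ->
  L1 (fun w => inner (A w) (B w)).
Proof.
move=> sepK mA mB hA hB.
apply: (@L1_le _ _ _ _ _ (fun w => `|A w| ^+ 2 + `|B w| ^+ 2)).
- exact: measurable_inner.
- move=> w; apply: (le_trans (normr_inner_le _ _)).
  have := sqr_ge0 (`|A w| - `|B w|).
  by have := sqr_ge0 `|A w|; have := sqr_ge0 `|B w|; nra.
- exact: L1D.
Qed.

Lemma L1_sqr_normB (K : hilbertType R) (A B : Omega -> K) : separable K ->
  borel_measurable A -> borel_measurable B ->
  L1 (fun w => `|A w| ^+ 2) -> L1 (fun w => `|B w| ^+ 2) ->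
  L1 (fun w => `|A w - B w| ^+ 2).
Proof.
move=> sepK mA mB hA hB.
apply: (@L1_le _ _ _ _ _ (fun w => 2 * (`|A w| ^+ 2 + `|B w| ^+ 2))).
- by apply: measurable_funX; apply: measurable_norm; exact: borel_measurableB.
- move=> w; rewrite ger0_norm ?sqr_ge0//.
  by apply: (le_trans (sqr_normD_le _ _)); rewrite normrN.
- by apply: L1Z; exact: L1D.
Qed.

Hypothesis F4 : L1 (fun w => `|F (pth (causal_index 1) w)| ^+ 4).
Hypothesis G4 : L1 (fun w => `|G (pth (causal_index 1) w)| ^+ 4).

Definition path_tens (x : H) (s : pathType (S:=S) nat) : H' := tens (F s) (G s) x.

Lemma borel_path_tens x : borel_measurable (path_tens x).
Proof. exact: borel_measurable_tens. Qed.

Let mPT x sigma : borel_measurable (fun w => path_tens x (pth sigma w)).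
Proof. by apply: path_measurable; exact: borel_path_tens. Qed.

Lemma L1_path_tens sigma x : injective sigma ->
  L1 (fun w => `|path_tens x (pth sigma w)| ^+ 2).
Proof.
move=> isig.
apply: (@L1_le _ _ _ _ _ (fun w => `|x| ^+ 2 *
  (`|F (pth sigma w)| ^+ 4 + `|G (pth sigma w)| ^+ 4))).
- by apply: measurable_funX; exact: measurable_norm.
- move=> w; rewrite ger0_norm ?sqr_ge0//.
  rewrite /path_tens /tens normrZ exprMn real_normK ?num_real//.
  set a := F _; set b := G _.
  apply: (@le_trans _ _ (`|a| ^+ 2 * `|x| ^+ 2 * `|b| ^+ 2)).
    by rewrite ler_wpM2r ?sqr_ge0// sqr_inner_le.
  rewrite mulrAC mulrC ler_wpM2l ?sqr_ge0//.
  rewrite -[4%N]/(2 * 2)%N !exprM.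
  have := sqr_ge0 (`|a| ^+ 2 - `|b| ^+ 2).
  by have := sqr_ge0 (`|a| ^+ 2); have := sqr_ge0 (`|b| ^+ 2); nra.
- by apply: L1Z; apply: L1D; exact: L1_moment4.
Qed.

Let L1PT sigma tau x : injective sigma -> injective tau ->
  L1 (fun w => inner (path_tens x (pth sigma w)) (path_tens x (pth tau w))).
Proof. by move=> isig itau; apply: L1_inner => //; exact: L1_path_tens. Qed.

Variable M : H -> H'.
Hypothesis hM : forall x y,
  E (fun w => inner (path_tens x (pth (causal_index 1) w)) y) = inner (M x) y.

Lemma mean_path_tens sigma x y : injective sigma ->
  E (fun w => inner (path_tens x (pth sigma w)) y) = inner (M x) y.
Proof.
move=> isig; rewrite -hM.
apply: (mean_law (phi := fun s => inner (path_tens x s) y) isig (@causal_index_inj 1)).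
apply: measurable_inner => //; first exact: borel_path_tens.
exact: borel_measurable_cst.
Qed.

Lemma L1_path_tens_inner sigma x y : injective sigma ->
  L1 (fun w => inner (path_tens x (pth sigma w)) y).
Proof.
move=> isig; apply: L1_inner => //.
- exact: borel_measurable_cst.
- exact: L1_path_tens.
- exact: L1_cst.
Qed.

(** Integrating out either of the independent paths replaces its factor by the mean [M x]. *)
Lemma mean_inner_indep sigma tau x : injective sigma -> injective tau ->
  (forall i j, sigma i <> tau j) ->
  E (fun w => inner (path_tens x (pth sigma w)) (path_tens x (pth tau w))) =
  `|M x| ^+ 2.
Proof.
move=> isig itau dis.
pose h (s : pathType (S:=S) nat * pathType (S:=S) nat) :=
  (inner (path_tens x s.1) (path_tens x s.2))%:E.
have mh : measurable_fun setT h.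
  apply/measurable_EFinP; apply: measurable_inner => //.
    exact: (borel_measurable_comp_fun measurable_fst (borel_path_tens x)).
  exact: (borel_measurable_comp_fun measurable_snd (borel_path_tens x)).
have ih : P.-integrable setT (fun w => h (pth sigma w, pth tau w)).
  exact: (L1PT x isig itau).
rewrite /mean /Rintegral (iid_indep_integral (false, 0) innov isig itau dis mh ih).
rewrite (eq_integral (fun w => (inner (path_tens x (pth sigma w)) (M x))%:E)).
  transitivity (inner (M x) (M x)); first exact: (mean_path_tens x (M x) isig).
  by rewrite sqr_norm_inner.
move=> w _; rewrite /h /=; set a := path_tens x (pth sigma w).
have -> : (fun w' => (inner a (path_tens x (pth tau w')))%:E) =
    (fun w' => (inner (path_tens x (pth tau w')) a)%:E).
  by apply/funext => w'; rewrite innerC.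
by rewrite -EFin_mean ?mean_path_tens// 1?innerC//; exact: L1_path_tens_inner.
Qed.

Definition centered (k : nat) (x : H) (w : Omega) : H' :=
  path_tens x (pth (causal_index k) w) - M x.

Lemma borel_centered k x : borel_measurable (centered k x).
Proof. by apply: borel_measurableB => //; exact: borel_measurable_cst. Qed.

Lemma L1_centered k x : L1 (fun w => `|centered k x w| ^+ 2).
Proof.
apply: L1_sqr_normB => //; first exact: borel_measurable_cst.
- by apply: L1_path_tens; exact: causal_index_inj.
- exact: L1_cst.
Qed.

Lemma mean_inner_centered k l x :
  E (fun w => inner (centered k x w) (centered l x w)) =
  E (fun w => inner (path_tens x (pth (causal_index k) w))
                    (path_tens x (pth (causal_index l) w))) - `|M x| ^+ 2.
Proof.
have ik := @causal_index_inj k; have il := @causal_index_inj l.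
transitivity (E (fun w =>
    inner (path_tens x (pth (causal_index k) w)) (path_tens x (pth (causal_index l) w)) -
    inner (path_tens x (pth (causal_index k) w)) (M x) -
    (inner (path_tens x (pth (causal_index l) w)) (M x) - `|M x| ^+ 2))).
  congr mean; apply/funext => w; rewrite /centered !innerBl !innerBr.
  by rewrite (innerC (M x) (path_tens x _)) sqr_norm_inner.
have h1 := L1PT x ik il.
have h2 := L1_path_tens_inner x (M x) ik.
have h3 := L1_path_tens_inner x (M x) il.
rewrite meanB; [|exact: L1B|by apply: L1B => //; exact: L1_cst].
rewrite meanB// meanB//; last exact: L1_cst.
by rewrite mean_cst !mean_path_tens// -sqr_norm_inner subrr subr0.
Qed.

Local Notation momF := (E (fun w => `|F (pth (causal_index 1) w)| ^+ 4)).
Local Notation momG := (E (fun w => `|G (pth (causal_index 1) w)| ^+ 4)).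

Variable e : nat -> H.
Hypothesis oe : orthonormal_seq e.

(** Centering only decreases the second moment, and the squared Hilbert-Schmidt norm of the tensor
    is at most [|F|^2 |G|^2]; this is where fourth moments are needed. *)
Lemma sum_mean_sqr_centered_le k J :
  \sum_(j < J) E (fun w => `|centered k (e j) w| ^+ 2) <= momF + momG.
Proof.
have ik := @causal_index_inj k.
have -> : \sum_(j < J) E (fun w => `|centered k (e j) w| ^+ 2) =
  \sum_(j < J) E (fun w => inner (centered k (e j) w) (centered k (e j) w)).
  by apply: eq_bigr => j _; congr mean; apply/funext => w; rewrite sqr_norm_inner.
apply: (@le_trans _ _ (\sum_(j < J)
    E (fun w => `|path_tens (e j) (pth (causal_index k) w)| ^+ 2))).
  apply: ler_sum => j _; rewrite mean_inner_centered.
  rewrite lerBlDr -[leLHS]addr0 lerD ?sqr_ge0//.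
  by rewrite le_eqVlt; apply/orP; left; apply/eqP; congr mean; apply/funext => w;
    rewrite sqr_norm_inner.
rewrite -mean_sum; last by move=> j; exact: L1_path_tens.
rewrite -(moment4_law mF ik) -(moment4_law mG ik).
rewrite -meanD; [|exact: L1_moment4|exact: L1_moment4].
apply: mean_le.
- by apply: L1_sum => j; exact: L1_path_tens.
- by apply: L1D; exact: L1_moment4.
move=> w; apply: (le_trans (sum_sqr_norm_tens_le oe _ _ _)).
set a := F _; set b := G _.
rewrite -[4%N]/(2 * 2)%N !exprM.
have := sqr_ge0 (`|a| ^+ 2 - `|b| ^+ 2).
by have := sqr_ge0 (`|a| ^+ 2); have := sqr_ge0 (`|b| ^+ 2); nra.
Qed.

(* Replacing the later factor by its coupled version makes the two independent;
   the price is the coupling error at lag [m]. *)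
Lemma sum_mean_cross_le k m (r : R) J : 0 < r ->
  E (fun w => `|F (pth (causal_index m) w) -
                F (pth (coupled_index m m) w)| ^+ 4) <= r ^+ 4 ->
  E (fun w => `|G (pth (causal_index m) w) -
                G (pth (coupled_index m m) w)| ^+ 4) <= r ^+ 4 ->
  \sum_(j < J) E (fun w => inner (centered k (e j) w) (centered (k + m) (e j) w)) <=
  r * (1 + momF + momG).
Proof.
move=> r0 hF hG.
have ik := @causal_index_inj k; have il := @causal_index_inj (k + m).
have it := @coupled_index_inj m (k + m).
have dis := @causal_coupled_disjoint k m.
(* The squared mean equals the same expectation with the coupled, independent path as second factor,
   so the covariance becomes one expectation of a difference of tensors. *)
have e1 j : E (fun w => inner (centered k (e j) w) (centered (k + m) (e j) w)) =
  E (fun w => inner (path_tens (e j) (pth (causal_index k) w))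
     (path_tens (e j) (pth (causal_index (k + m)) w) -
      path_tens (e j) (pth (coupled_index m (k + m)) w))).
  rewrite mean_inner_centered -(mean_inner_indep (e j) ik it dis).
  rewrite -meanB; [|exact: L1PT|exact: L1PT].
  by congr mean; apply/funext => w; rewrite innerBr.
under eq_bigr do rewrite e1.
rewrite -mean_sum; last first.
  move=> j; apply: L1_inner => //.
  - exact: borel_measurableB.
  - exact: L1_path_tens.
  - by apply: L1_sqr_normB => //; exact: L1_path_tens.
pose q w := r / 4 * (`|F (pth (causal_index k) w)| ^+ 4 +
                     `|G (pth (causal_index k) w)| ^+ 4) +
  (2 * r)^-1 *
   (r ^- 2 * `|F (pth (causal_index (k + m)) w) - F (pth (coupled_index m (k + m)) w)| ^+ 4 +
    r ^+ 2 * `|G (pth (causal_index (k + m)) w)| ^+ 4 +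
    (r ^+ 2 * `|F (pth (coupled_index m (k + m)) w)| ^+ 4 +
     r ^- 2 * `|G (pth (causal_index (k + m)) w) - G (pth (coupled_index m (k + m)) w)| ^+ 4)).
have a1 := L1_moment4 mF F4 ik.
have a2 := L1_moment4 mG G4 ik.
have a3 := L1_moment4 mG G4 il.
have a4 := L1_moment4 mF F4 it.
have a5 := L1_coupling4 sepH mF F4 il it.
have a6 := L1_coupling4 sepH' mG G4 il it.
have Lq : L1 q.
  by apply: L1D; apply: L1Z; apply: L1D => //; apply: L1D; exact: L1Z.
apply: (@le_trans _ _ (E q)).
  apply: mean_le => //.
    apply: L1_sum => j; apply: L1_inner => //.
    - exact: borel_measurableB.
    - exact: L1_path_tens.
    - by apply: L1_sqr_normB => //; exact: L1_path_tens.
  by move=> w; exact: sum_inner_tens_le.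
rewrite /q meanD; [|by apply: L1Z; exact: L1D
                  |by apply: L1Z; apply: L1D; apply: L1D; exact: L1Z].
rewrite meanZ ?meanD//; last exact: L1D.
rewrite meanZ; last by apply: L1D; apply: L1D; exact: L1Z.
rewrite meanD; [|by apply: L1D; exact: L1Z|by apply: L1D; exact: L1Z].
rewrite meanD; [|exact: L1Z|exact: L1Z].
rewrite meanD; [|exact: L1Z|exact: L1Z].
rewrite !meanZ//.
rewrite (moment4_law mF ik) (moment4_law mG ik).
rewrite (moment4_law mG il) (moment4_law mF it).
rewrite (coupling4_shift sepH mF) (coupling4_shift sepH' mG).
have mF0 : 0 <= momF by apply: mean_ge0 => w; rewrite exprn_ge0.
have mG0 : 0 <= momG by apply: mean_ge0 => w; rewrite exprn_ge0.
have r2 : 0 <= r ^- 2 by rewrite invr_ge0 exprn_ge0// ltW.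
have hF' := ler_wpM2l r2 hF; have hG' := ler_wpM2l r2 hG.
have r4 : r ^- 2 * r ^+ 4 = r ^+ 2 by field; rewrite gt_eqF.
rewrite r4 in hF' hG'.
move: hF' hG'; move: (r ^- 2 * _) => u hF'; move: (r ^- 2 * _) => v hG'.
apply: (@le_trans _ _ (r / 4 * (momF + momG) +
  (2 * r)^-1 * (r ^+ 2 + r ^+ 2 * momG + (r ^+ 2 * momF + r ^+ 2)))).
  rewrite lerD2l ler_wpM2l ?invr_ge0 ?mulr_ge0 ?(ltW r0)//.
  by apply: lerD; rewrite ?lerD2l ?lerD2r.
have -> : r / 4 * (momF + momG) +
  (2 * r)^-1 * (r ^+ 2 + r ^+ 2 * momG + (r ^+ 2 * momF + r ^+ 2)) =
  r * (1 + 3 / 4 * (momF + momG)) by field; rewrite gt_eqF.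
rewrite ler_wpM2l ?(ltW r0)// -addrA lerD2l.
by rewrite ler_piMl ?addr_ge0//; lra.
Qed.

Variables (r : nat -> R) (rho : R).
Hypothesis r0 : forall m, 0 < r m.
Hypothesis rrho : forall N, \sum_(1 <= m < N) r m <= rho.
Hypothesis hrF : forall m, (0 < m)%N ->
  E (fun w => `|F (pth (causal_index m) w) -
                F (pth (coupled_index m m) w)| ^+ 4) <= r m ^+ 4.
Hypothesis hrG : forall m, (0 < m)%N ->
  E (fun w => `|G (pth (causal_index m) w) -
                G (pth (coupled_index m m) w)| ^+ 4) <= r m ^+ 4.

Definition centered_sum N x w := \sum_(1 <= k < N.+1) centered k x w.

Lemma borel_centered_sum N x : borel_measurable (centered_sum N x).
Proof. by apply: borel_measurable_sum => // k _; exact: borel_centered. Qed.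

Lemma centered_sumS N x w :
  centered_sum N.+1 x w = centered_sum N x w + centered N.+1 x w.
Proof. by rewrite /centered_sum big_nat_recr. Qed.

Lemma L1_centered_sum N x : L1 (fun w => `|centered_sum N x w| ^+ 2).
Proof.
elim: N => [|N IH].
  under eq_fun do rewrite /centered_sum big_geq// normr0 expr0n; exact: L1_cst.
apply: (@L1_le _ _ _ _ _
  (fun w => 2 * (`|centered_sum N x w| ^+ 2 + `|centered N.+1 x w| ^+ 2))).
- apply: measurable_funX; apply: measurable_norm; exact: borel_centered_sum.
- by move=> w; rewrite ger0_norm ?sqr_ge0// centered_sumS sqr_normD_le.
- by apply: L1Z; apply: L1D => //; exact: L1_centered.
Qed.

(** Each new term adds its variance and twice its covariances with the earlier terms. The covariance
    at lag [m] costs at most [r m] times a constant, so summability of [r] bounds the increment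
    uniformly in [N]. *)
Lemma sum_mean_sqr_centered_sum_le N J :
  \sum_(j < J) E (fun w => `|centered_sum N (e j) w| ^+ 2) <=
  N%:R * ((1 + momF + momG) * (1 + 2 * rho)).
Proof.
have mF0 : 0 <= momF by apply: mean_ge0 => w; rewrite exprn_ge0.
have mG0 : 0 <= momG by apply: mean_ge0 => w; rewrite exprn_ge0.
elim: N => [|N IH].
  rewrite mul0r big1// => j _.
  by under eq_fun do rewrite /centered_sum big_geq// normr0 expr0n; rewrite mean_cst.
have L1c k l x : L1 (fun w => inner (centered k x w) (centered l x w)).
  by apply: L1_inner => //; [exact: borel_centered|exact: borel_centered|
     exact: L1_centered|exact: L1_centered].
have step j : E (fun w => `|centered_sum N.+1 (e j) w| ^+ 2) =
  E (fun w => `|centered_sum N (e j) w| ^+ 2) +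
  2 * (\sum_(1 <= k < N.+1)
         E (fun w => inner (centered k (e j) w) (centered N.+1 (e j) w))) +
  E (fun w => `|centered N.+1 (e j) w| ^+ 2).
  have -> : (fun w => `|centered_sum N.+1 (e j) w| ^+ 2) =
    (fun w => `|centered_sum N (e j) w| ^+ 2 +
       2 * (\sum_(1 <= k < N.+1) inner (centered k (e j) w) (centered N.+1 (e j) w))
       + `|centered N.+1 (e j) w| ^+ 2).
    by apply/funext => w; rewrite centered_sumS sqr_normD [in inner _ _]/centered_sum inner_suml.
  have hs : L1 (fun w => \sum_(1 <= k < N.+1)
      inner (centered k (e j) w) (centered N.+1 (e j) w)) by apply: L1_sum.
  rewrite meanD; [|by apply: L1D; [exact: L1_centered_sum|exact: L1Z]|exact: L1_centered].
  rewrite meanD; [|exact: L1_centered_sum|exact: L1Z].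
  by rewrite meanZ// mean_sum.
under eq_bigr do rewrite step.
rewrite !big_split /= -mulr_sumr exchange_big /=.
have hd := sum_mean_sqr_centered_le N.+1 J.
have hc : \sum_(1 <= k < N.+1) \sum_(j < J)
    E (fun w => inner (centered k (e j) w) (centered N.+1 (e j) w)) <=
  rho * (1 + momF + momG).
  apply: (@le_trans _ _ (\sum_(1 <= k < N.+1) r (N.+1 - k) * (1 + momF + momG))).
    rewrite !big_nat; apply: ler_sum => k /andP[k1 kN].
    have := @sum_mean_cross_le k (N.+1 - k) (r (N.+1 - k)) J (r0 _).
    rewrite subnKC; last exact: ltnW.
    by apply; [apply: hrF|apply: hrG]; rewrite subn_gt0.
  rewrite -mulr_suml ler_wpM2r ?addr_ge0//.
  apply: le_trans (rrho N.+1); rewrite [leRHS]big_nat_rev /= add1n.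
  by rewrite le_eqVlt; apply/orP; left; apply/eqP; apply: eq_bigr => k _; rewrite subSS.
rewrite -natr1 mulrDl mul1r.
have -> : (1 + momF + momG) * (1 + 2 * rho) =
  (1 + momF + momG) + 2 * (rho * (1 + momF + momG)) by ring.
move: IH; rewrite (_ : (1 + momF + momG) * (1 + 2 * rho) =
  (1 + momF + momG) + 2 * (rho * (1 + momF + momG))); last by ring.
by move: hc hd; lra.
Qed.

End SecondMoments.

(** * Empirical and population covariance operators *)

Section EmpiricalCovariance.
Context {d : measure_display} {Omega : measurableType d} {R : realType}.
Variables (H H' : hilbertType R).
Variables (X : nat -> Omega -> H) (W : nat -> Omega -> H').

Lemma tens_linear (x : H) (y : H') : linear (tens x y).
Proof. by move=> a u v; rewrite /tens innerDr innerZr scalerDl scalerA. Qed.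

Lemma emp_cov_linear n w : linear (emp_cov X W n w).
Proof.
move=> a u v; rewrite /emp_cov scalerA mulrC -scalerA -scalerDr; congr (_ *: _).
rewrite scaler_sumr -big_split /=; apply: eq_bigr => k _; exact: tens_linear.
Qed.

Lemma emp_cov_continuous n w : continuous (emp_cov X W n w).
Proof.
apply: (linear_bounded_cvg (emp_cov_linear n w)
  (b := n%:R^-1 * \sum_(1 <= k < n.+1) `|X k w| * `|W k w|)) => x.
rewrite /emp_cov normrZ ger0_norm ?invr_ge0// -mulrA ler_wpM2l ?invr_ge0//.
rewrite mulr_suml (le_trans (ler_norm_sum _ _ _))//; apply: ler_sum => k _.
by rewrite /tens normrZ mulrAC ler_wpM2r// normr_inner_le.
Qed.

Lemma emp_cov_model (Y : nat -> Omega -> H') (Psi : H -> H') n w x :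
  linear Psi -> (forall k, (0 < k)%N -> Y k w = Psi (X k w) + W k w) ->
  emp_cov X Y n w x = Psi (emp_cov X X n w x) + emp_cov X W n w x.
Proof.
move=> linPsi hY; rewrite /emp_cov (linZ linPsi) (lin_sum linPsi) -scalerDr.
congr (_ *: _); rewrite -big_split /= big_nat [RHS]big_nat; apply: eq_bigr => k /andP[k0 _].
by rewrite /tens hY// (linZ linPsi) scalerDr.
Qed.

End EmpiricalCovariance.

Lemma inner_tens (R : realType) (H : hilbertType R) (x u v : H) :
  inner (tens x x u) v = inner x u * inner x v.
Proof. by rewrite /tens innerZl. Qed.

(** Bessel, applied to each [X k], bounds the trace by the average squared norm; for the population
    covariance the same holds under the expectation. *)
Lemma emp_cov_trace_le d (Omega : measurableType d) (R : realType)
    (H : hilbertType R) (X : nat -> Omega -> H) n w :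
  trace_le (emp_cov X X n w) (n%:R^-1 * \sum_(1 <= k < n.+1) `|X k w| ^+ 2).
Proof.
have innerE u v : inner (emp_cov X X n w u) v =
    n%:R^-1 * \sum_(1 <= k < n.+1) inner (X k w) u * inner (X k w) v.
  by rewrite /emp_cov innerZl inner_suml; under eq_bigr do rewrite inner_tens.
split.
- exact: emp_cov_linear.
- move=> u v; rewrite innerE innerC innerE; congr (_ * _).
  by apply: eq_bigr => k _; rewrite mulrC.
- move=> u; rewrite innerE mulr_ge0 ?invr_ge0//.
  by apply: sumr_ge0 => k _; rewrite -expr2 sqr_ge0.
- move=> J u ou; under eq_bigr do rewrite innerE.
  rewrite -mulr_sumr ler_wpM2l ?invr_ge0// exchange_big /=.
  apply: ler_sum => k _; apply: le_trans (Bessel (X k w) ou).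
  by apply: ler_sum => j _; rewrite -expr2 innerC.
Qed.

Lemma covariance_trace_le d (Omega : measurableType d) (R : realType)
    (P : probability Omega R) (H : hilbertType R) (X : Omega -> H) (C : H -> H) :
  separable H -> borel_measurable X -> L1 P (fun w => `|X w| ^+ 2) ->
  is_mean_tens P X X C ->
  trace_le C (mean P (fun w => `|X w| ^+ 2)).
Proof.
move=> sepH mX X2 hC.
have mi x : measurable_fun setT (fun w => inner (X w) x).
  by apply: measurable_inner => //; exact: borel_measurable_cst.
have L1xy x y : L1 P (fun w => inner (X w) x * inner (X w) y).
  apply: (@L1_le _ _ _ _ _ (fun w => (`|x| * `|y|) * `|X w| ^+ 2)).
  - exact: measurable_funM.
  - move=> w; rewrite normrM.
    have -> : `|x| * `|y| * `|X w| ^+ 2 = `|X w| * `|x| * (`|X w| * `|y|) by ring.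
    by apply: ler_pM => //; exact: normr_inner_le.
  - exact: L1Z.
have CE x y : inner (C x) y = mean P (fun w => inner (X w) x * inner (X w) y).
  have [_ _ /(_ y)] := hC x; rewrite unlock => h.
  rewrite /mean /Rintegral -[LHS]/(fine (inner (C x) y)%:E) -h.
  by congr fine; apply: eq_integral => w _; rewrite inner_tens.
split.
- move=> a u v; apply: inner_extr => z; rewrite innerDl innerZl !CE.
  rewrite -meanZ// -meanD//; last exact: L1Z.
  by congr mean; apply/funext => w; rewrite innerDr innerZr; ring.
- move=> x y; rewrite CE innerC CE; congr mean; apply/funext => w; exact: mulrC.
- by move=> x; rewrite CE; apply: mean_ge0 => w; rewrite -expr2 sqr_ge0.
- move=> J u ou; under eq_bigr do rewrite CE.
  rewrite -mean_sum//; apply: mean_le => //; first exact: L1_sum.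
  move=> w; apply: le_trans (Bessel (X w) ou).
  by apply: ler_sum => j _; rewrite -expr2 innerC.
Qed.

Lemma geometric_sum_le1 (R : realType) N : \sum_(1 <= m < N) (2^-1 : R) ^+ m <= 1.
Proof.
case: N => [|N]; first by rewrite big_geq.
suff -> : \sum_(1 <= m < N.+1) (2^-1 : R) ^+ m = 1 - 2^-1 ^+ N.
  by rewrite gerBl exprn_ge0// invr_ge0.
elim: N => [|N IH]; first by rewrite big_geq// expr0 subrr.
by rewrite big_nat_recr//= IH exprS; field.
Qed.

(** * Mean square error of empirical covariances *)

Section Concentration.
Context {d dS : measure_display} {Omega : measurableType d} {S : measurableType dS}.
Context {R : realType} (P : probability Omega R).
Variables (delta delta' : int -> Omega -> S).
Hypothesis innov : innovations P delta delta'.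

Local Notation Z := (fun bi : bool * int => if bi.1 then delta' bi.2 else delta bi.2).
Local Notation pth := (sample Z).

Lemma coupled_causalE (K : Type) (f : (nat -> S) -> K) m n w :
  coupled_causal f delta delta' m n w = f (pth (coupled_index m n) w).
Proof.
rewrite /coupled_causal; congr f; apply/funext => i.
by rewrite /sample /coupled_index /=; case: (i < m)%N.
Qed.

(** Real-valued form of approximability: [a m] is the L^4 norm of the coupling error, so [a m ^+ 4]
    is its fourth moment, and summability becomes a bound on partial sums. *)
Lemma approximable_moments (K : hilbertType R) (X : nat -> Omega -> K) :
  separable K -> Lp_m_approximable P 4 delta delta' X ->
  exists f : pathType (S:=S) nat -> K, [/\ borel_measurable f,
    (forall n, (0 < n)%N -> X n = fun w => f (pth (causal_index n) w)),
    L1 P (fun w => `|f (pth (causal_index 1) w)| ^+ 4) &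
    exists a : nat -> R, exists A : R, [/\ (forall m, 0 <= a m),
      (forall N, \sum_(1 <= m < N) a m <= A) &
      forall m, (0 < m)%N -> mean P (fun w => `|f (pth (causal_index m) w) -
          f (pth (coupled_index m m) w)| ^+ 4) = a m ^+ 4]].
Proof.
move=> sepK [f [mf Xf Xfin Xsum]].
have bf : borel_measurable (f : pathType nat -> K).
  by move=> U oU; apply: cylinders_measurable; exact: mf.
have mfp sigma : borel_measurable (fun w => f (pth sigma w)).
  exact: (path_measurable innov).
have XE n : (0 < n)%N -> X n = fun w => f (pth (causal_index n) w).
  by move=> n0; rewrite Xf.
exists f; split => //.
  have := Xfin 1%N isT; rewrite XE// => /nu4_moment[]//.
  exact: measurable_norm.
pose D m w := f (pth (causal_index m) w) - f (pth (coupled_index m m) w).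
have DE m : (0 < m)%N ->
    (fun w => X m w - coupled_causal f delta delta' m m w) = D m.
  by move=> m0; apply/funext => w; rewrite XE// coupled_causalE.
have sumD : (\sum_(1 <= m <oo) nu P 4 (D m) < +oo)%E.
  apply: le_lt_trans Xsum; rewrite le_eqVlt; apply/orP; left; apply/eqP.
  congr (limn _); apply/funext => N; rewrite !big_nat; apply: eq_bigr => m /andP[m1 _].
  by rewrite -DE.
have nu0 m : (0 <= nu P 4 (D m))%E by exact: Lnorm_ge0.
have partial N : (\sum_(1 <= m < N) nu P 4 (D m) <= \sum_(1 <= m <oo) nu P 4 (D m))%E.
  by apply: nneseries_lim_ge => m _ _.
have nufin m : (0 < m)%N -> nu P 4 (D m) \is a fin_num.
  move=> m0; rewrite ge0_fin_numE//; apply: le_lt_trans sumD.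
  apply: le_trans (partial m.+1); rewrite big_nat_recr//= leeDr//.
  by apply: sume_ge0 => i _.
exists (fun m => fine (nu P 4 (D m))), (fine (\sum_(1 <= m <oo) nu P 4 (D m))%E).
split.
- by move=> m; rewrite fine_ge0.
- move=> N; rewrite -lee_fin fineK; last first.
    by rewrite ge0_fin_numE//; apply: nneseries_ge0 => m _ _.
  apply: le_trans (partial N); rewrite le_eqVlt; apply/orP; left; apply/eqP.
  rewrite -sumEFin !big_nat; apply: eq_bigr => m /andP[m1 _].
  by rewrite fineK// nufin.
- move=> m m0; have [] := @nu4_moment _ _ _ P K (D m).
  + by apply: measurable_norm; exact: borel_measurableB.
  + by rewrite -ge0_fin_numE// nufin.
  + by move=> _ ->.
Qed.

(** The integrand is the squared Hilbert-Schmidt norm of the error: it dominates the squared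
    operator norm and is a countable sum of measurable functions. It serves both for [W = X], with
    mean [C], and for the noise, with mean 0. *)
Lemma emp_cov_concentration (H H' : hilbertType R) (X : nat -> Omega -> H)
    (W : nat -> Omega -> H') (M : H -> H') (e : nat -> H) :
  separable H -> separable H' ->
  Lp_m_approximable P 4 delta delta' X -> Lp_m_approximable P 4 delta delta' W ->
  is_mean_tens P (X 1%N) (W 1%N) M -> orthonormal_seq e ->
  (forall n x, (0 < n)%N ->
     borel_measurable (fun w => emp_cov X W n w x - M x)) /\
  exists c : R, forall n, (0 < n)%N ->
    (\int[P]_w (\sum_(0 <= j <oo) (`|emp_cov X W n w (e j) - M (e j)| ^+ 2)%:E)
     <= (c / n%:R)%:E)%E.
Proof.
move=> sepH sepH' hX hW hM oe.
have [f [bf XE f4 [a [A [a0 aA fa]]]]] := approximable_moments sepH hX.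
have [g [bg WE g4 [b [B [b0 bB gb]]]]] := approximable_moments sepH' hW.
have hM' x y : mean P (fun w => inner (path_tens f g x (pth (causal_index 1) w)) y) =
    inner (M x) y.
  have [_ _ /(_ y)] := hM x; rewrite unlock => h.
  rewrite /mean /Rintegral -[RHS]/(fine (inner (M x) y)%:E) -h.
  by congr fine; apply: eq_integral => w _; rewrite XE// WE.
(* One sequence must dominate both coupling errors and be positive, as it is divided by; the
   geometric term ensures this and stays summable. *)
pose r m := a m + b m + 2^-1 ^+ m.
have r0 m : 0 < r m by rewrite ltr_wpDl ?addr_ge0// exprn_gt0// invr_gt0.
have rrho N : \sum_(1 <= m < N) r m <= A + B + 1.
  by rewrite !big_split /= lerD ?geometric_sum_le1// lerD.
have hrF m : (0 < m)%N -> mean P (fun w => `|f (pth (causal_index m) w) -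
    f (pth (coupled_index m m) w)| ^+ 4) <= r m ^+ 4.
  move=> m0; rewrite fa// lerXn2r// ?nnegrE//; first exact: ltW.
  by rewrite /r -addrA lerDl addr_ge0// exprn_ge0// invr_ge0.
have hrG m : (0 < m)%N -> mean P (fun w => `|g (pth (causal_index m) w) -
    g (pth (coupled_index m m) w)| ^+ 4) <= r m ^+ 4.
  move=> m0; rewrite gb// lerXn2r// ?nnegrE//; first exact: ltW.
  by rewrite /r addrAC lerDr addr_ge0// exprn_ge0// invr_ge0.
have cov_sum n w x : (0 < n)%N -> emp_cov X W n w x - M x =
    n%:R^-1 *: centered_sum delta delta' f g M n x w.
  move=> n0; rewrite /centered_sum sumrB scalerBr.
  rewrite sumr_const_nat subSS subn0 -[X in _ - _ *: X]scaler_nat scalerA mulVf ?pnatr_eq0 -?lt0n//.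
  rewrite scale1r /emp_cov; congr (_ *: _ - _).
  by rewrite !big_nat; apply: eq_bigr => k /andP[k0 _]; rewrite XE// WE.
have bsum n x := borel_centered_sum innov sepH sepH' bf bg M n x.
split.
  move=> n x n0; under eq_fun do rewrite cov_sum//.
  exact: borel_measurableZ.
(* The constant is read off at the end: the uniform increment of the second moment of the centered
   sums. The sum has second moment of order [n], and averaging divides by [n^2]. *)
eexists => n n0.
rewrite integral_nneseries//; last first.
  move=> j; apply/measurable_EFinP; apply: measurable_funX.
  apply: measurable_norm; under eq_fun do rewrite cov_sum//.
  exact: borel_measurableZ.
apply: lime_le.
  apply: is_cvg_nneseries => j _ _.
  by apply: integral_ge0 => w _; rewrite lee_fin sqr_ge0.
near=> J; rewrite big_mkord.
have intE (j : 'I_J) : (\int[P]_w (`|emp_cov X W n w (e j) - M (e j)| ^+ 2)%:E)%E =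
    (n%:R ^- 2 * mean P (fun w => `|centered_sum delta delta' f g M n (e j) w| ^+ 2))%:E.
  have L1c := L1_centered_sum innov sepH sepH' bf bg f4 g4 M n (e j).
  rewrite -meanZ// EFin_mean; last exact: L1Z.
  apply: eq_integral => w _; rewrite cov_sum// normrZ exprMn real_normK ?num_real//.
  by rewrite exprVn.
under eq_bigr do rewrite intE.
rewrite sumEFin lee_fin -mulr_sumr.
have := sum_mean_sqr_centered_sum_le innov sepH sepH' bf bg f4 g4 hM' oe r0 rrho hrF hrG n J.
move=> /(ler_wpM2l (_ : 0 <= n%:R ^- 2)) h.
apply: (le_trans (h _)); first by rewrite invr_ge0 exprn_ge0.
rewrite expr2 invfM -mulrA mulKf ?pnatr_eq0 -?lt0n// mulrC.
exact: lexx.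
Unshelve. all: by end_near.
Qed.

End Concentration.

(** * Consistency in probability *)

Lemma hilbert_schmidt_norm_le (R : realType) (H H' : hilbertType R) (e : nat -> H)
    (T : H -> H') (s : R) : orthonormal_basis e -> linear T -> continuous T ->
  0 <= s -> (\sum_(0 <= j <oo) (`|T (e j)| ^+ 2)%:E <= (s ^+ 2)%:E)%E ->
  forall x, `|T x| <= s * `|x|.
Proof.
move=> be linT cT s0 hs x.
have h N : \sum_(0 <= j < N) `|T (e j)| ^+ 2 <= s ^+ 2.
  rewrite -lee_fin -sumEFin; apply: le_trans hs.
  by apply: nneseries_lim_ge => j _ _; rewrite lee_fin sqr_ge0.
have := hilbert_schmidt_tail linT be cT s0 h x.
by rewrite big_ord0 subr0.
Qed.

(** The event [A] about the estimator involves arbitrary eigenvectors; only the sets covering it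
    have to be measurable. *)
Lemma outer_measure_le d (T : measurableType d) (R : realType)
    (P : probability T R) (A B D : set T) :
  measurable B -> measurable D -> A `<=` B `|` D ->
  ((P^*)%mu A <= P B + P D)%E.
Proof.
move=> mB mD AB; apply: (@le_trans _ _ ((P^*)%mu (B `|` D))).
  exact: le_mu_ext.
rewrite measurable_mu_extE; last exact: measurableU.
exact: measureU2.
Qed.

Theorem theorem1 (R : realType) (d : measure_display)
    (Omega : measurableType d) (P : probability Omega R)
    (dS : measure_display) (S : measurableType dS)
    (delta delta' : int -> Omega -> S)
    (H1 H2 : hilbertType R)
    (Psi : H1 -> H2)
    (X : nat -> Omega -> H1) (eps Y : nat -> Omega -> H2)
    (C : H1 -> H1) (lam : nat -> R) (v : nat -> H1)
    (m : nat -> R)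
    (lamh : nat -> Omega -> nat -> R) (vh : nat -> Omega -> nat -> H1)
    (sepH1 : separable H1) (sepH2 : separable H2)
    (dimH1 : infinite_dimensional H1)
    (hA : assumption_A P delta delta' Psi X eps)
    (hY : forall k w, (0 < k)%N -> Y k w = Psi (X k w) + eps k w)
    (hC : is_mean_tens P (X 1%N) (X 1%N) C)
    (imC : closure (range C) = setT)
    (hlam : eigensystem C lam v)
    (lam_distinct : forall i j, (0 < i)%N -> (0 < j)%N -> i <> j ->
      lam i <> lam j)
    (hHS : hilbert_schmidt Psi)
    (m_infty : m n @[n --> \oo] --> +oo)
    (m_growth : (fun n : nat => m n ^+ 6) =o_\oo (fun n : nat => n%:R : R))
    (hhat : forall n w, (0 < n)%N ->
      eigensystem (emp_cov X X n w) (lamh n w) (vh n w)) :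
  cvg_probability0 P (fun n w =>
    opnorm (fun x => Psi_hat (emp_cov X Y n w) (lamh n w) (vh n w)
                       (Kn (lamh n w) (m n)) x - Psi x)).
Proof.
case: hA => linPsi cPsi innov _ _ hX heps _ horth.
(* The basis provided with [Psi] also serves to compute the Hilbert-Schmidt norms of the two random
   errors. *)
have [e be he] := hHS.
have oe := be.1.
have hC' : trace_le C (mean P (fun w => `|X 1%N w| ^+ 2)).
  have [f [bf XE f4 _]] := approximable_moments innov sepH1 hX.
  apply: covariance_trace_le => //; rewrite XE//.
    exact: (path_measurable innov).
  exact: (L1_moment2 innov bf f4 (@causal_index_inj 1)).
have [b Psib] : exists b, forall N, \sum_(0 <= j < N) `|Psi (e j)| ^+ 2 <= b.
  exists (fine (\sum_(0 <= j <oo) (`|Psi (e j)| ^+ 2)%:E)%E) => N.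
  rewrite -lee_fin fineK; last first.
    by rewrite ge0_fin_numE//; apply: nneseries_ge0 => j _ _; rewrite lee_fin sqr_ge0.
  rewrite -sumEFin; apply: nneseries_lim_ge => j _ _.
  by rewrite lee_fin sqr_ge0.
have [bX [c1 hc1]] := emp_cov_concentration innov sepH1 sepH1 hX hX hC oe.
have [bE [c2 hc2]] := emp_cov_concentration innov sepH1 sepH2 hX heps (horth 1%N isT) oe.
move=> t t0.
have t2 : 0 < t / 2 by rewrite divr_gt0.
have [eta eta0 [m0 hclose]] :=
  estimator_close be hC' hlam imC linPsi cPsi Psib lam_distinct t2.
pose HX n w := (\sum_(0 <= j <oo) (`|emp_cov X X n w (e j) - C (e j)| ^+ 2)%:E)%E.
pose HE n w := (\sum_(0 <= j <oo) (`|emp_cov X eps n w (e j) - 0| ^+ 2)%:E)%E.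
have mHX n : (0 < n)%N -> measurable_fun setT (HX n).
  move=> n0; apply: ge0_emeasurable_sum => [j w _ _|j _]; first by rewrite lee_fin sqr_ge0.
  by apply/measurable_EFinP; apply: measurable_funX; apply: measurable_norm; exact: bX.
have mHE n : (0 < n)%N -> measurable_fun setT (HE n).
  move=> n0; apply: ge0_emeasurable_sum => [j w _ _|j _]; first by rewrite lee_fin sqr_ge0.
  by apply/measurable_EFinP; apply: measurable_funX; apply: measurable_norm; exact: bE.
have HX0 n w : (0 <= HX n w)%E by apply: nneseries_ge0 => j _ _; rewrite lee_fin sqr_ge0.
have HE0 n w : (0 <= HE n w)%E by apply: nneseries_ge0 => j _ _; rewrite lee_fin sqr_ge0.
(* [m n * s n = t / 2] is the largest amplified noise that the deterministic estimate tolerates. *)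
pose s n := t / 2 / m n.
have bound n : (0 < n)%N -> 0 < m n -> m0 <= m n ->
  ((P^*)%mu [set w | t%:E < opnorm (fun x => Psi_hat (emp_cov X Y n w) (lamh n w)
      (vh n w) (Kn (lamh n w) (m n)) x - Psi x)%R] <=
   ((eta ^+ 2)^-1 * (c1 / n%:R) + (s n ^+ 2)^-1 * (c2 / n%:R))%:E)%E.
  move=> n0 mn0 m0n.
  have s0 : 0 < s n by rewrite divr_gt0.
  have e20 : 0 < eta ^+ 2 by rewrite exprn_gt0.
  have s20 : 0 < s n ^+ 2 by rewrite exprn_gt0.
  pose B := [set w | ((eta ^+ 2)%:E <= HX n w)%E].
  pose D := [set w | ((s n ^+ 2)%:E <= HE n w)%E].
  have mB : measurable B.
    by rewrite -[B]setTI; apply: emeasurable_fun_c_infty => //; exact: mHX.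
  have mD : measurable D.
    by rewrite -[D]setTI; apply: emeasurable_fun_c_infty => //; exact: mHE.
  apply: (@le_trans _ _ (P B + P D)%E).
    (* Off [B] and [D] both Hilbert-Schmidt norms, hence both operator norms, are small, and the
       deterministic estimate excludes the bad event. *)
    apply: outer_measure_le => // w /= hw; apply: contrapT => /not_orP[/negP hB /negP hD].
    move: hw; apply/negP; rewrite -leNgt.
    rewrite -ltNge in hB; rewrite -ltNge in hD.
    have tt : t = 2 * (t / 2) by field.
    rewrite tt.
    apply: (hclose (emp_cov X X n w) _ (lamh n w) (vh n w) (m n)
              (emp_cov X eps n w) (emp_cov X Y n w) (s n)).
    - exact: emp_cov_trace_le.
    - exact: hhat.
    - apply: (hilbert_schmidt_norm_le be (T := fun x => emp_cov X X n w x - C x)).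
      + move=> a u z; rewrite (emp_cov_linear X X n w) (trace_linear hC').
        by rewrite scalerBr opprD addrACA.
      + move=> x; apply: cvgB; first exact: emp_cov_continuous.
        exact: (trace_le_continuous hC').
      + exact: ltW.
      + exact: ltW.
    - exact: m0n.
    - exact: emp_cov_linear.
    - by move=> x; apply: emp_cov_model => // k k0; exact: hY.
    - apply: (hilbert_schmidt_norm_le be) => //.
      + exact: emp_cov_linear.
      + exact: emp_cov_continuous.
      + exact: ltW.
      + apply: le_trans (ltW hD); rewrite /HE.
        by under [leRHS]eq_eseriesr do rewrite subr0.
    - by rewrite /s mulrC divfK// gt_eqF.
  rewrite EFinD; apply: leeD.
    apply: (le_trans (Markov P (mHX _ n0) (HX0 n) e20)).
    rewrite EFinM lee_pmul2l// ?lte_fin ?invr_gt0//; exact: hc1.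
  apply: (le_trans (Markov P (mHE _ n0) (HE0 n) s20)).
  rewrite EFinM lee_pmul2l// ?lte_fin ?invr_gt0//; exact: hc2.
have m1 : \forall n \near \oo, 1 <= m n /\ m0 <= m n.
  move/cvgryPge : m_infty => h; near=> n; split; near: n; exact: h.
have small k : 0 < k -> \forall n \near \oo, m n ^+ 2 / n%:R <= k.
  move=> k0; move/eqoP : m_growth => /(_ _ k0) h.
  near=> n.
  have n0 : (0 : R) < n%:R by rewrite ltr0n; near: n; exact: nbhs_infty_gt.
  have [mn1 _] : 1 <= m n /\ m0 <= m n by near: n.
  rewrite ler_pdivrMr//.
  have : `|m n ^+ 6| <= k * `|n%:R : R| by near: n.
  rewrite [`|n%:R|]ger0_norm ?ler0n// => /(le_trans (ler_norm _)).
  (* Once [m n >= 1], the square is dominated by the sixth power. *)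
  exact: le_trans (ler_weXn2l mn1 (isT : (2 <= 6)%N)).
pose K := (eta ^+ 2)^-1 * `|c1| + (t / 2) ^- 2 * `|c2|.
have K0 : 0 <= K.
  by rewrite addr_ge0// mulr_ge0// invr_ge0 exprn_ge0// ltW.
apply: (@squeeze_cvge _ _ _ _ (fun=> 0%E) _ (fun n => (K * (m n ^+ 2 / n%:R))%:E)).
- near=> n; rewrite mu_ext_ge0 /=.
  have n0 : (0 < n)%N by near: n; exact: nbhs_infty_gt.
  have [mn1 m0n] : 1 <= m n /\ m0 <= m n by near: n.
  have mn0 : 0 < m n by exact: lt_le_trans mn1.
  apply: (le_trans (bound _ n0 mn0 m0n)); rewrite lee_fin /K mulrDl.
  have nn : (0 : R) < n%:R by rewrite ltr0n.
  apply: lerD.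
    rewrite -mulrA ler_wpM2l ?invr_ge0 ?exprn_ge0 ?(ltW eta0)//.
    rewrite mulrA ler_wpM2r ?invr_ge0 ?(ltW nn)//.
    apply: (le_trans (ler_norm _)); rewrite ler_peMr//.
    by rewrite expr_ge1// (le_trans ler01).
  have -> : (s n ^+ 2)^-1 * (c2 / n%:R) = (t / 2) ^- 2 * (c2 * (m n ^+ 2 / n%:R)).
    by rewrite /s; field; rewrite !gt_eqF.
  rewrite -[leRHS]mulrA; apply: ler_wpM2l; first by rewrite invr_ge0 exprn_ge0 ?(ltW t2).
  by rewrite ler_wpM2r ?ler_norm// divr_ge0 ?exprn_ge0 ?(ltW mn0) ?(ltW nn).
- by [].
- exact: cvg_cst.
- apply: cvg_EFin; first by near=> n.
  apply/cvgr0Pnorm_le => k k0.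
  (* [K] may be 0, hence the division by [K + 1]. *)
  have k1 : 0 < k / (K + 1) by rewrite divr_gt0// ltr_wpDl.
  near=> n.
  have q0 : 0 <= m n ^+ 2 / n%:R by rewrite divr_ge0// sqr_ge0.
  have h : m n ^+ 2 / n%:R <= k / (K + 1) by near: n; exact: small.
  rewrite ger0_norm; last by rewrite mulr_ge0.
  apply: (@le_trans _ _ ((K + 1) * (m n ^+ 2 / n%:R))).
    by rewrite ler_wpM2r// lerDl.
  by rewrite mulrC -ler_pdivlMr// ltr_wpDl.
Unshelve. all: by end_near.
Qed.
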